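(* Let $n\ge2$ and let $\Omega\subset\mathbb{R}^n$ be a (nonempty) bounded domain, with a fixed family of paths $\gamma$ satisfying $(\gamma.a)$–$(\gamma.d)$ and associated weight $\omega$. Let $1<p\leq+\infty$ and $1\leq q<+\infty$ be such that $\frac1p+\frac1q=1$. Then $(P_q)$ holds if and only if $(\mathrm{div}_p)$ holds.
   Context: A domain is a connected open set. For $x\in\Omega$, $d(x)$ is the distance from $x$ to $\partial\Omega$. For $x,y\in\Omega$, $\mathrm{dist}_\Omega(y,x)$ is the infimum of the lengths of rectifiable paths in $\Omega$ joining $y$ to $x$. A reference point $x_0\in\Omega$ is fixed and $d_\Omega(y):=\mathrm{dist}_\Omega(y,x_0)$. For $s>0$, $\Omega_s=\{z\in\Omega;\ d(z)>s\}$. The length of a path is denoted by $l(\cdot)$, and the image of a path is denoted by the same letter as the path. For each $y\in\Omega$, $\gamma(y)$ is a path $t\in[0,1]\mapsto\gamma(t,y)$. The properties are: $(\gamma.a)$ for all $y\in\Omega$ and $t\in[0,1]$, $\gamma(t,y)\in\Omega$, with $\gamma(0,y)=y$ and $\gamma(1,y)=x_0$; $(\gamma.b)$ $(t,y)\mapsto\gamma(t,y)$ is measurable and $\gamma(y)$ is rectifiable; $(\gamma.c)$ there exists a constant $C>0$, only depending on the dimension, such that for all $x,y\in\Omega$: $l(\gamma(y)\cap B(x,r))\leq Cr$ for all $r\leq\frac12 d(x)$, and $l(\gamma(y))\leq C\,d_\Omega(y)$; $(\gamma.d)$ for all $\varepsilon>0$ small enough there exists $\delta>0$ such that $\gamma(y)\subset\Omega_\delta$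 for all $y\in\Omega_\varepsilon$. The weight associated with $\gamma$ is $$\omega(x)=\left|\left\{y\in\Omega;\ \mathrm{dist}_\Omega(\gamma(y),x)\leq\tfrac12 d(x)\right\}\right|,\qquad x\in\Omega,$$ where $\mathrm{dist}_\Omega(\gamma(y),x)$ is the distance in $\Omega$ from the path $\gamma(y)$ to the point $x$ and $|\cdot|$ is Lebesgue measure. $E^q(\Omega)$ is the space of $g\in L^q(\Omega)$, with distributional gradient a function, such that $\int_\Omega|\nabla g(x)|^q\left(\frac{\omega(x)}{d^{n-1}(x)}\right)^q dx<+\infty$. $(P_q)$: there is a constant $C>0$ such that for all $g\in E^q(\Omega)$, $$\Vert g-g_\Omega\Vert_{L^q(\Omega)}\leq C\left\Vert\frac{\omega}{d^{n-1}}|\nabla g|\right\Vert_{L^q(\Omega)},\qquad g_\Omega:=\frac1{|\Omega|}\int_\Omega g(x)\,dx.$$ $(\mathrm{div}_p)$: there is a constant $C>0$, only depending (for the fixed $p$) on $\Omega$ and the choice of the paths $\gamma$, such that for all $f\in L^p(\Omega)$ with $\int_\Omega f=0$ there exists a vector-valued function $u$ with $$\int_\Omega u\cdot\nabla\varphi=-\int_\Omega f\varphi\quad\text{for all }\varphi\in E^q(\Omega)$$ (this is the meaning of $\mathrm{div}\,u=f$ in $\Omega$, $u\cdot\nu=0$ on $\partial\Omega$) and $\left\Vert\frac{d^{n-1}}{\omega}u\right\Vert_p\leq C\Vert f\Vert_p$. *)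

(* Defs.v *)
From HB Require Import structures.
From mathcomp Require Import all_boot all_order all_algebra.
From mathcomp Require Import all_classical all_reals all_analysis.

Set Implicit Arguments.
Unset Strict Implicit.
Unset Printing Implicit Defensive.

Import Order.TTheory GRing.Theory Num.Theory.
Import numFieldNormedType.Exports.

Local Open Scope classical_set_scope.
Local Open Scope ring_scope.

(* The norm of the library on 'rV[R]_n is the sup norm; it induces the usual
   topology and bounded sets, but distances, lengths and moduli of vectors are
   Euclidean, hence the following. *)
Definition edot (R : realType) n (u v : 'rV[R]_n) : R :=
  \sum_(i < n) u ord0 i * v ord0 i.

Definition enorm (R : realType) n (u : 'rV[R]_n) : R := Num.sqrt (edot u u).

Definition eball (R : realType) n (x : 'rV[R]_n) (r : R) : set 'rV[R]_n :=
  [set z | enorm (z - x) < r].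

(* n-dimensional Lebesgue measure: the Caratheodory measure of the outer
   measure given by countable coverings by boxes ]a_i, b_i]. *)
Definition box (R : realType) n (c : 'rV[R]_n * 'rV[R]_n) : set 'rV[R]_n :=
  [set x | forall i, c.1 ord0 i < x ord0 i <= c.2 ord0 i].

Definition box_volume (R : realType) n (c : 'rV[R]_n * 'rV[R]_n) : \bar R :=
  (\prod_(i < n) Num.max 0 (c.2 ord0 i - c.1 ord0 i))%:E.

Definition lebesgue_outer (R : realType) n (A : set 'rV[R]_n) : \bar R :=
  ereal_inf [set (\esum_(c in B) box_volume c)%E | B in
    [set B : set ('rV[R]_n * 'rV[R]_n) |
      countable B /\ A `<=` \bigcup_(c in B) box c]].

Section lebesgue_outer_measure.
Context (R : realType) (n : nat).
Local Open Scope ereal_scope.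
Local Notation mu := (@lebesgue_outer R n).

Lemma box_volume_ge0 (c : 'rV[R]_n * 'rV[R]_n) : 0 <= box_volume c.
Proof.
by rewrite lee_fin; apply: prodr_ge0 => i _; rewrite le_max lexx.
Qed.

Lemma lebesgue_outer_ge0 A : 0 <= mu A.
Proof.
apply: le_ereal_inf_tmp => _ [B _ <-].
by apply: esum_ge0 => c _; exact: box_volume_ge0.
Qed.

Lemma lebesgue_outer0 : mu set0 = 0.
Proof.
apply/eqP; rewrite eq_le lebesgue_outer_ge0 andbT.
apply: ereal_inf_lbound; exists set0; last by rewrite esum_set0.
by split; [exact: countable0|exact: sub0set].
Qed.

Lemma le_lebesgue_outer : {homo mu : A B / A `<=` B >-> A <= B}.
Proof.
move=> A A' AA'; apply: ereal_inf_le_tmp => _ [B [cB AB] <-].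
by exists B => //; split=> //; exact: subset_trans AA' AB.
Qed.

Lemma lebesgue_outer_sigma_subadditive : sigma_subadditive mu.
Proof.
move=> A; have [[i ioo]|] := pselect (exists i, mu (A i) = +oo).
  rewrite (eseries_pinfty _ _ ioo) ?leey// => k _.
  by rewrite -ltNye (lt_le_trans _ (lebesgue_outer_ge0 _)).
rewrite -forallNE => Aoo.
apply/lee_addgt0Pr => _/posnumP[e].
rewrite (le_trans _ (epsilon_trick _ _ _))//; last first.
  by move=> k; exact: lebesgue_outer_ge0.
pose P k (B : set ('rV[R]_n * 'rV[R]_n)) :=
  (countable B /\ A k `<=` \bigcup_(c in B) box c) /\
  \esum_(c in B) box_volume c <= mu (A k) + (e%:num / (2 ^ k.+1)%:R)%:E.
have [G PG] : {G & forall k, P k (G k)}.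
  apply: (@choice _ _ P) => k; rewrite /P /lebesgue_outer.
  set S := (X in ereal_inf X).
  have fS : ereal_inf S \is a fin_num.
    by rewrite ge0_fin_numE ?lebesgue_outer_ge0// ltey; apply/eqP/Aoo.
  have en1 : (0 < e%:num / (2 ^ k.+1)%:R :> R)%R by [].
  have [_ [B BA <-] /ltW xS] := lb_ereal_inf_adherent en1 fS.
  by exists B.
apply: (@le_trans _ _ (\esum_(c in \bigcup_k G k) box_volume c)).
  apply: ereal_inf_lbound; exists (\bigcup_k G k) => //; split.
    by apply: bigcup_countable => // k _; have [[]] := PG k.
  move=> x [k _ /(PG k).1.2 [c Gc cx]].
  by exists c => //; exists k.
rewrite seqDU_bigcup_eq esum_bigcupT; last 2 first.
- exact: trivIset_seqDU.
- by move=> c; exact: box_volume_ge0.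
rewrite -nneseries_esumT; last first.
  by move=> k; apply: esum_ge0 => c _; exact: box_volume_ge0.
apply: lee_nneseries => [k _ _|k _].
  by apply: esum_ge0 => c _; exact: box_volume_ge0.
apply: le_trans (PG k).2.
rewrite esum_mkcond [leRHS]esum_mkcond; apply: le_esum => c _.
case: ifPn => [|_].
  by rewrite inE => Gc; rewrite mem_set //; exact: subset_seqDU Gc.
by case: ifPn => // _; exact: box_volume_ge0.
Qed.

HB.instance Definition _ := isOuterMeasure.Build R 'rV[R]_n mu
  lebesgue_outer0 lebesgue_outer_ge0 le_lebesgue_outer
  lebesgue_outer_sigma_subadditive.

End lebesgue_outer_measure.

Definition Rn (R : realType) n := caratheodory_type (@lebesgue_outer R n).

Definition lebesgue (R : realType) n : set (Rn R n) -> \bar R :=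
  @lebesgue_outer R n.

HB.instance Definition _ (R : realType) n :=
  isMeasure.Build _ (Rn R n) R (@lebesgue R n)
    (caratheodory_measure0 (@lebesgue_outer R n))
    (caratheodory_measure_ge0 (mu := @lebesgue_outer R n))
    (caratheodory_measure_sigma_additive (mu := @lebesgue_outer R n)).

Section domain_distances.
Context (R : realType) (n : nat).
Implicit Types (Omega A : set 'rV[R]_n) (x y : 'rV[R]_n) (p : R -> 'rV[R]_n).

Definition bdist Omega x : R :=
  inf [set enorm (x - z) | z in closure Omega `\` interior Omega].

Definition inner_part Omega (s : R) : set 'rV[R]_n :=
  [set z | Omega z /\ s < bdist Omega z].

(* Length of the part of the path p, parametrized by [0, 1], which lies in A,
   counted with multiplicity: in the polygonal sums of the partitions of [0, 1]
   one keeps the subintervals which p maps into A. For A open this is the sum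
   of the lengths of p on the components of its preimage of A, and for
   A = setT the length of p. *)
Definition polygonal_sum_in A p (s : seq R) : R :=
  let F := nth 1 (0 :: s) in
  \sum_(0 <= k < size s | `[< forall t, F k <= t <= F k.+1 -> A (p t) >])
    enorm (p (F k.+1) - p (F k)).

Definition length_in A p : \bar R :=
  ereal_sup [set (polygonal_sum_in A p s)%:E | s in itv_partition 0 1].

Definition path_length p : \bar R := length_in setT p.

Definition rectifiable p : Prop := (path_length p < +oo)%E.

Definition is_path p : Prop := {within `[0, 1], continuous p}.

Definition dist_in Omega y x : \bar R :=
  ereal_inf [set path_length p | p in
    [set p | [/\ is_path p, rectifiable p,
                 (forall t, 0 <= t <= 1 -> Omega (p t)),
                 p 0 = y & p 1 = x]]].

Definition path_dist_in Omega p x : \bar R :=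
  ereal_inf [set dist_in Omega (p t) x | t in `[0, 1]].

(* gamma t y is the point of parameter t of the path from y to x0.
   In path_measurable the parameters carry the Borel sigma-algebra, the points
   of Omega the Lebesgue one; since each path is continuous and Lebesgue measure
   is complete, this is equivalent to Lebesgue measurability in R^(n+1). *)
Record path_family (C : R) Omega x0 (gamma : R -> 'rV[R]_n -> 'rV[R]_n) : Prop :=
  PathFamily {
    path_continuous : forall y, Omega y -> is_path (gamma^~ y) ;
    path_in : forall y t, Omega y -> 0 <= t <= 1 -> Omega (gamma t y) ;
    path_start : forall y, Omega y -> gamma 0 y = y ;
    path_end : forall y, Omega y -> gamma 1 y = x0 ;
    path_measurable : forall i : 'I_n,
      measurable_fun (`[0, 1] `*` Omega : set (R * Rn R n))
        (fun ty => gamma ty.1 ty.2 ord0 i) ;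
    path_rectifiable : forall y, Omega y -> rectifiable (gamma^~ y) ;
    path_ball : forall x y r, Omega x -> Omega y ->
      0 < r <= bdist Omega x / 2 ->
      (length_in (eball x r) (gamma^~ y) <= (C * r)%:E)%E ;
    path_length_le : forall y, Omega y ->
      (path_length (gamma^~ y) <= C%:E * dist_in Omega y x0)%E ;
    path_inner : exists2 eps0 : R, 0 < eps0 & forall eps, 0 < eps < eps0 ->
      exists2 delta : R, 0 < delta & forall y t, inner_part Omega eps y ->
        0 <= t <= 1 -> inner_part Omega delta (gamma t y) }.

Definition omega Omega (gamma : R -> 'rV[R]_n -> 'rV[R]_n) x : \bar R :=
  @lebesgue R n [set y | Omega y /\
    (path_dist_in Omega (gamma^~ y) x <= (bdist Omega x / 2)%:E)%E].

(* omega / d^(n-1); omega is finite when Omega is bounded. *)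
Definition weight Omega gamma x : R :=
  fine (omega Omega gamma x) / bdist Omega x ^+ n.-1.

End domain_distances.

Section function_spaces.
Context (R : realType) (n : nat).
Implicit Types (Omega : set 'rV[R]_n) (f g phi : 'rV[R]_n -> R)
  (u G : 'rV[R]_n -> 'rV[R]_n) (gamma : R -> 'rV[R]_n -> 'rV[R]_n).

Local Notation mu := (@lebesgue R n).

(* Functions on Omega are total functions whose values off Omega are ignored. *)
Definition LnormOn Omega (p : \bar R) f : \bar R :=
  'N[mu]_p [EFin \o (f \_ Omega)].

Definition LpOn Omega (p : \bar R) f : Prop :=
  (f \_ Omega : Rn R n -> R) \in Lfun mu p.

Definition partial (i : 'I_n) phi : 'rV[R]_n -> R :=
  fun x => 'D_(delta_mx ord0 i) phi x.

Definition smooth phi : Prop := forall s : seq 'I_n,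
  let psi := foldr partial phi s in
  continuous psi /\ forall i x, derivable psi x (delta_mx ord0 i).

Definition test_function Omega phi : Prop :=
  let supp := closure [set x | phi x != 0] in
  [/\ smooth phi, compact supp & supp `<=` Omega].

Definition locally_integrable_on Omega g : Prop :=
  measurable_fun (Omega : set (Rn R n)) g /\
  forall K, compact K -> K `<=` Omega -> mu.-integrable K (EFin \o g).

Definition weak_gradient Omega g G : Prop :=
  forall i : 'I_n, locally_integrable_on Omega (fun x => G x ord0 i) /\
    forall phi, test_function Omega phi ->
      \int[mu]_(x in Omega) (g x * partial i phi x) =
      - \int[mu]_(x in Omega) (G x ord0 i * phi x).

(* G plays the role of the gradient of g, which is only determined a.e. *)
Definition Eq_space Omega gamma (q : R) g G : Prop :=
  [/\ LpOn Omega q%:E g, weak_gradient Omega g G &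
      (\int[mu]_(x in Omega)
         ((enorm (G x) `^ q) * (weight Omega gamma x `^ q))%:E < +oo)%E].

Definition mean Omega g : R :=
  (fine (mu Omega))^-1 * \int[mu]_(x in Omega) g x.

Definition weighted_poincare Omega gamma (q : R) : Prop :=
  exists2 C : R, 0 < C & forall g G, Eq_space Omega gamma q g G ->
    (LnormOn Omega q%:E (fun x => g x - mean Omega g)%R
     <= C%:E *
        LnormOn Omega q%:E (fun x => weight Omega gamma x * enorm (G x))%R)%E.

(* The integral identity is the weak form of div u = f in Omega together with
   u . nu = 0 on the boundary. *)
Definition divergence_solvable Omega gamma (p : \bar R) (q : R) : Prop :=
  exists2 C : R, 0 < C & forall f, LpOn Omega p f ->
    \int[mu]_(x in Omega) f x = 0 ->
    exists u, [/\
      forall i : 'I_n,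
        measurable_fun (Omega : set (Rn R n)) (fun x => u x ord0 i),
      forall phi G, Eq_space Omega gamma q phi G ->
        \int[mu]_(x in Omega) (edot (u x) (G x)) =
        - \int[mu]_(x in Omega) (f x * phi x) &
      (LnormOn Omega p (fun x => (weight Omega gamma x)^-1 * enorm (u x))%R
       <= C%:E * LnormOn Omega p f)%E].

End function_spaces.

(* Main.v *)
(* [(P_q) -> (div_p)]: for f of mean zero, Hoelder's inequality applied to g - g_Omega
    and (P_q) show that [w grad g |-> - int f g] is a well defined functional
    dominated by [|f|_p] times a weighted L^q norm. Hahn-Banach extends it to all
    of [(L^q)^n], and the Riesz representation of its components, obtained from the
    Radon-Nikodym theorem, gives [h] in [(L^p)^n] such that [u = w h] solves the
    divergence problem.
    [(div_p) -> (P_q)]: with [h = g - g_Omega], take f to be [sgn h |h|^(q-1)] minus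
    its mean; then [|h|_q^q = int f g = - int u . grad g], and Hoelder's inequality
    for the pair [u / w], [w grad g] concludes.
    The weight is measurable because omega is upper semicontinuous, and positive
    because a small ball around x consists of starting points of paths close to x. *)

From HB Require Import structures.
Require Import Defs.
From mathcomp Require Import all_boot all_order all_algebra.
From mathcomp Require Import all_classical all_reals all_analysis.
From mathcomp Require Import measurable_realfun ess_sup_inf ring lra.

Set Implicit Arguments.
Unset Strict Implicit.
Unset Printing Implicit Defensive.

Import Order.TTheory GRing.Theory Num.Theory.
Import numFieldNormedType.Exports.

Local Open Scope classical_set_scope.
Local Open Scope ring_scope.

(** * Lebesgue measure *)

(** That the functional in the first implication is well defined needs no separate argument: a
    linear subspace of V x R lying below a sublinear gauge is automatically the graph of a function,
    because two values over one vector differ by a value over 0, where the gauge vanishes.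
    Functionals are therefore handled as graphs until Hahn-Banach has made them total. The gauge on
    (L^q)^n is C |f|_p times the sum of the norms of the components. Each coordinate functional then
    has norm at most C |f|_p, and returning from the components of h to the Euclidean norm of u
    costs a factor n, whence the constant n C. The endpoint p = +oo, q = 1 is part of the claim. It
    calls for its own test functions in the Riesz representation, where the bound on the density is
    an essential bound instead of a bound on an integral. In the second implication the admissible
    data must have mean zero. Subtracting the mean multiplies the L^p norm by at most a constant K
    depending on the measure of Omega and the exponents, and (P_q) comes out with the constant C
    K. *)

Lemma outer_measure_countable_cover (R : realType) (T : Type) (I : choiceType)
    (mu : {outer_measure set T -> \bar R}) (B : set I) (F : I -> set T)
    (X : set T) :
  countable B -> X `<=` \bigcup_(c in B) F c ->
  (mu X <= \esum_(c in B) mu (F c))%E.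
Proof.
move=> /countable_injP[f injf] XF.
(* The injection [f] numbers the elements of [B]; [g k] is the set numbered [k], or empty when there
   is none, which turns the cover into a sequence. *)
pose g : nat -> set T := fun k => \bigcup_(c in B `&` [set c | f c = k]) F c.
have gf c : B c -> g (f c) = F c.
  move=> Bc; apply/seteqP; split=> [x [c' [Bc' /injf -> //]]|x Fcx].
  - exact: mem_set.
  - exact: mem_set.
  - by exists c.
apply: (@le_trans _ _ (mu (\bigcup_k g k))).
  apply: le_outer_measure => x /XF[c Bc Fcx]; exists (f c) => //.
  by rewrite gf.
apply: le_trans (outer_measure_sigma_subadditive mu g) _.
rewrite nneseries_esumT; last by move=> k; exact: outer_measure_ge0.
under [leRHS]eq_esum => c Bc do rewrite -(gf c Bc).
rewrite -(@reindex_esum _ _ _ B (f @` B) f (mu \o g)); last first.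
  exact: inj_bij.
rewrite [leRHS]esum_mkcond; apply: le_esum => k _ /=.
case: ifPn => //; rewrite notin_setE => kB.
rewrite (_ : g k = set0) ?outer_measure0//.
apply/seteqP; split=> // x [c [Bc fc] _]; apply: kB.
by exists c.
Qed.

Section lebesgue_measure_theory.
Context (R : realType) (n : nat).
Local Notation mu := (@lebesgue_outer R n).
Local Notation V := ('rV[R]_n).

Lemma lebesgue_outer_box (c : V * V) : (mu (box c) <= box_volume c)%E.
Proof.
apply: ereal_inf_lbound; exists [set c].
  split; first exact: countable1.
  by move=> x cx; exists c.
by rewrite esum_set1// box_volume_ge0.
Qed.

(** This and [box_above] are the pieces of a box cut by the hyperplane x_i = a. A piece that the
    hyperplane leaves empty gets reversed bounds, and the truncation at 0 in [box_volume] gives it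
    volume 0. *)
Definition box_below (i : 'I_n) (a : R) (c : V * V) : V * V :=
  (c.1, \row_j if j == i then Num.min (c.2 ord0 j) a else c.2 ord0 j).

Definition box_above (i : 'I_n) (a : R) (c : V * V) : V * V :=
  (\row_j (if j == i then Num.max (c.1 ord0 j) a else c.1 ord0 j), c.2).

Lemma box_volume_cut (i : 'I_n) (a : R) (c : V * V) :
  (box_volume (box_below i a c) + box_volume (box_above i a c) = box_volume c)%E.
Proof.
rewrite /box_volume -EFinD; congr EFin.
rewrite (bigD1 i)//= [X in _ + X = _](bigD1 i)//= [RHS](bigD1 i)//=.
rewrite !mxE eqxx.
under eq_bigr => j /negPf ji do rewrite mxE ji.
under [X in _ + _ * X = _]eq_bigr => j /negPf ji do rewrite mxE ji.
rewrite -mulrDl; congr (_ * _).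
rewrite /Num.max /Num.min.
move: (c.1 ord0 i) (c.2 ord0 i) => l b.
by case: (ltP b a) => ?; case: (ltP l a) => ?; do !case: ltP => ?; lra.
Qed.

(** Caratheodory's criterion holds because every box of a cover of [X] is cut by the hyperplane into
    two boxes whose volumes add up: the two families of pieces cover the two parts of [X]. *)
Lemma measurable_halfspace (i : 'I_n) (a : R) :
  measurable ([set x | x ord0 i <= a] : set (Rn R n)).
Proof.
apply: le_caratheodory_measurable => X.
apply: le_ereal_inf_tmp => _ [B [cB XB] <-].
apply: (@le_trans _ _ (\esum_(c in B) box_volume (box_below i a c) +
                       \esum_(c in B) box_volume (box_above i a c))%E).
  apply: leeD.
  - apply: le_trans (@outer_measure_countable_cover _ _ _ mu B
      (fun c => box (box_below i a c)) _ cB _) _.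
    + move=> x [/XB[c Bc cx] xa]; exists c => //= j; rewrite mxE.
      by case: ifPn => [/eqP ->|_]; [rewrite le_min andbA cx|exact: cx].
    + by apply: le_esum => c _; exact: lebesgue_outer_box.
  - apply: le_trans (@outer_measure_countable_cover _ _ _ mu B
      (fun c => box (box_above i a c)) _ cB _) _.
    + move=> x [/XB[c Bc cx] /negP]; rewrite -ltNge => xa.
      exists c => //= j; rewrite mxE.
      by case: ifPn => [/eqP ->|_]; [rewrite gt_max xa andbT cx|exact: cx].
    + by apply: le_esum => c _; exact: lebesgue_outer_box.
rewrite -esumD; [|by move=> *; exact: box_volume_ge0..].
by under eq_esum do rewrite box_volume_cut.
Qed.

Lemma measurable_box (c : V * V) : measurable (box c : set (Rn R n)).
Proof.
rewrite (_ : box c = \bigcap_i ([set x | x ord0 i <= c.2 ord0 i] `\`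
                                [set x | x ord0 i <= c.1 ord0 i])).
  apply: fin_bigcap_measurable; first exact: finite_finset.
  by move=> i _; apply: measurableD; exact: measurable_halfspace.
apply/seteqP; split=> [x cx i _|x cx i].
  by have /andP[? ?] := cx i; split => //=; apply/negP; rewrite -ltNge.
by have [? /negP] := cx i I; rewrite -ltNge => -> .
Qed.

Lemma rV_nbhsP (x : V) (U : set V) :
  nbhs x U <->
  exists2 e : R, 0 < e & forall y : V, (forall i, `|x ord0 i - y ord0 i| < e) -> U y.
Proof.
split=> [/nbhs_ballP[e e0 eU]|[e e0 eU]].
  by exists e => // y xy; apply: eU; split=> // i j; rewrite (ord1 i); exact: xy.
apply/nbhs_ballP; exists e => // y [_ xy]; apply: eU => i; exact: xy.
Qed.

Lemma rat_rV_between (a b : V) : (forall i, a ord0 i < b ord0 i) ->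
  exists q : 'rV[rat]_n, forall i, a ord0 i < ratr (q ord0 i) < b ord0 i.
Proof.
move=> ab.
have /choice[f fP] : forall i, exists q : rat, a ord0 i < ratr q < b ord0 i.
  by move=> i; have [q] := rat_in_itvoo (ab i); rewrite in_itv/=; exists q.
by exists (\row_i f i) => i; rewrite mxE.
Qed.

Definition rat_box (c : 'rV[rat]_n * 'rV[rat]_n) : set V :=
  box (map_mx ratr c.1, map_mx ratr c.2).

Lemma rV_open_bigcup_box (U : set V) : open U ->
  U = \bigcup_(c in [set c | rat_box c `<=` U]) rat_box c.
Proof.
move=> oU; apply/seteqP; split=> [x Ux|x [c cU /cU//]].
have [e e0 eU] := (rV_nbhsP x U).1 (open_nbhs_nbhs (conj oU Ux)).
have [a aP] : exists a : 'rV[rat]_n,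
    forall i, x ord0 i - e < ratr (a ord0 i) < x ord0 i.
  have [|a aP] := @rat_rV_between (\row_i (x ord0 i - e)) x.
    by move=> i; rewrite mxE; lra.
  by exists a => i; have := aP i; rewrite mxE.
have [b bP] : exists b : 'rV[rat]_n,
    forall i, x ord0 i < ratr (b ord0 i) < x ord0 i + e.
  have [|b bP] := @rat_rV_between x (\row_i (x ord0 i + e)).
    by move=> i; rewrite mxE; lra.
  by exists b => i; have := bP i; rewrite mxE.
exists (a, b) => [y By|i].
  apply: eU => i; have := By i; rewrite !mxE ltr_norml.
  by have := aP i; have := bP i; lra.
by rewrite !mxE; have := aP i; have := bP i; lra.
Qed.

(** There are countably many rational boxes, and membership in a box is tested coordinate by
    coordinate. It serves for the identity map and, later, for the maps [gamma (ratr q)]. *)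
Lemma measurable_preimage_open d (T : measurableType d) (D : set T)
    (f : T -> V) (U : set V) :
  measurable D -> (forall i, measurable_fun D (fun x => f x ord0 i)) ->
  open U -> measurable (D `&` f @^-1` U).
Proof.
move=> mD mf oU.
pose B c := D `&` f @^-1` (if `[< rat_box c `<=` U >] then rat_box c else set0).
rewrite (_ : D `&` _ = \bigcup_c B c).
  apply: countable_bigcupT_measurable; first exact: countableP.
  move=> c; rewrite /B; case: asboolP => _; last by rewrite preimage_set0 setI0.
  rewrite (_ : _ `&` _ = D `&` \bigcap_i (D `&` (fun x => f x ord0 i) @^-1`
      `]ratr (c.1 ord0 i), ratr (c.2 ord0 i)]%classic)).
    apply: measurableI => //; apply: fin_bigcap_measurable => //.
    by move=> i _; exact: mf.
  apply/seteqP; split=> x [Dx fx]; split=> // i.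
    by move=> _; split=> //=; have := fx i; rewrite !mxE in_itv.
  by have [_ /=] := fx i I; rewrite !mxE in_itv.
apply/seteqP; split=> [x [Dx]|x [c _ [Dx]]] /=.
  rewrite {1}(rV_open_bigcup_box oU) => -[c cU cx]; exists c => //.
  by split => //=; case: asboolP.
by case: asboolP => // cU /cU.
Qed.

Lemma measurable_coord (i : 'I_n) :
  measurable_fun [set: Rn R n] (fun x : Rn R n => x ord0 i).
Proof.
move=> mT; apply: (measurability _ (RGenOInfty.measurableE R)).
  move=> _ [_ [a ->] <-]; rewrite setTI.
  rewrite (_ : _ @^-1` _ = ~` [set x : V | x ord0 i <= a]).
    by apply: measurableC; exact: measurable_halfspace.
  by apply/seteqP; split=> x /=; rewrite in_itv/= andbT ltNge => /negP.
exact: mT.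
Qed.

Lemma measurable_rV_open (U : set V) : open U -> measurable (U : set (Rn R n)).
Proof.
move=> oU; rewrite -[X in measurable X](setTI (U : set (Rn R n))).
exact: (measurable_preimage_open (@measurableT _ (Rn R n)) measurable_coord oU).
Qed.

Lemma lebesgue_outer_shift (v : V) (X : set V) :
  mu [set x | X (x - v)] = mu X.
Proof.
(* One inequality is enough: the other one is the same inequality for [- v] and the translated
   set. *)
suff le (w : V) (Y : set V) : (mu [set x | Y (x - w)%R] <= mu Y)%E.
  apply/eqP; rewrite eq_le le /=.
  apply: le_trans (le (- v) [set x | X (x - v)]).
  by apply: le_outer_measure => x Xx /=; rewrite opprK addrK.
apply: le_ereal_inf_tmp => _ [B [cB YB] <-].
apply: le_trans (@outer_measure_countable_cover _ _ _ mu B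
  (fun c => box (c.1 + w, c.2 + w)) _ cB _) _.
  move=> x /YB[c Bc cx]; exists c => // i; have := cx i; rewrite !mxE.
  lra.
apply: le_esum => c _; apply: le_trans (lebesgue_outer_box _) _.
rewrite /box_volume; under eq_bigr do rewrite !mxE.
rewrite lee_fin; apply: ler_prod => i _; rewrite le_max lexx /=.
rewrite [leRHS](_ : _ =
    Num.max 0 (c.2 ord0 i + w ord0 i - (c.1 ord0 i + w ord0 i)))//.
by congr Num.max; ring.
Qed.

(* The translates of an open set by rational vectors cover the space, so that
   no volume computation is needed to see that open sets are not null. *)
Lemma open_null_lebesgue_outer_eq0 (U : set V) :
  open U -> U !=set0 -> mu U = 0%E -> forall A : set V, mu A = 0%E.
Proof.
move=> oU [u Uu] U0 A; apply/eqP; rewrite eq_le lebesgue_outer_ge0 andbT.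
have [e e0 eU] := (rV_nbhsP u U).1 (open_nbhs_nbhs (conj oU Uu)).
apply: le_trans (@outer_measure_countable_cover _ _ _ mu
  [set: 'rV[rat]_n] (fun q => [set x | U (x - map_mx ratr q)]) _ _ _) _.
- exact: countableP.
- move=> x _.
  have [|q qP] := @rat_rV_between (x - u - const_mx e) (x - u).
    by move=> i; rewrite !mxE; lra.
  exists q => //; apply: eU => i; have := qP i; rewrite !mxE ltr_norml; lra.
- rewrite esum1// => q _.
  exact: etrans (lebesgue_outer_shift (map_mx ratr q) U) U0.
Qed.

Lemma ler_coord_norm (x : V) (i : 'I_n) : `|x ord0 i| <= `|x|.
Proof.
rewrite [leRHS]/Num.norm/= mx_normrE.
exact: (le_bigmax _ (fun ij => `|x ij.1 ij.2|) (ord0, i)).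
Qed.

Lemma lebesgue_outer_bounded (A : set V) : bounded_set A -> (mu A < +oo)%E.
Proof.
move=> [M [_ AM]].
have MA x : A x -> `|x| <= `|M| + 1.
  by apply: AM; rewrite (le_lt_trans (ler_norm _))// ltrDl.
(* Boxes are open on their lower side, hence the lower bound one unit further out than the upper
   one. *)
apply: (@le_lt_trans _ _ (mu (box (const_mx (- (`|M| + 2)), const_mx (`|M| + 1))))).
  apply: le_outer_measure => x /MA xM i; rewrite !mxE.
  have : `|x ord0 i| <= `|M| + 1.
    exact: le_trans (ler_coord_norm x i) xM.
  rewrite ler_norml; lra.
by apply: le_lt_trans (lebesgue_outer_box _) _; exact: ltry.
Qed.

(** Sigma-finiteness is what Radon-Nikodym asks of the reference measure. *)
Lemma lebesgue_sigma_finite : sigma_finite [set: Rn R n] (@lebesgue R n).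
Proof.
exists (fun k => box (const_mx (- k%:R), const_mx k%:R)); last first.
  move=> k; split; first exact: measurable_box.
  by apply: le_lt_trans (lebesgue_outer_box _) _; exact: ltry.
apply/seteqP; split=> // x _.
pose M := \sum_i `|x ord0 i|.
exists (Num.truncn M).+1 => // i; rewrite !mxE.
have : `|x ord0 i| < (Num.truncn M).+1%:R.
  apply: (le_lt_trans _ (truncnS_gt M)).
  by rewrite /M (bigD1 i)//= lerDl sumr_ge0.
rewrite ltr_norml; lra.
Qed.

End lebesgue_measure_theory.

(** * Path distances and the weight *)

Section euclidean_norm.
Context (R : realType) (n : nat).
Implicit Types u v w : 'rV[R]_n.

Lemma edot_ge0 u : 0 <= edot u u.
Proof. by apply: sumr_ge0 => i _; rewrite -expr2 sqr_ge0. Qed.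

Lemma sqr_enorm u : enorm u ^+ 2 = edot u u.
Proof. by rewrite sqr_sqrtr// edot_ge0. Qed.

Lemma enorm_ge0 u : 0 <= enorm u.
Proof. exact: sqrtr_ge0. Qed.

Lemma ler_coord_enorm u i : `|u ord0 i| <= enorm u.
Proof.
rewrite -sqrtr_sqr ler_wsqrtr// /edot (bigD1 i)//= -expr2 lerDl.
by apply: sumr_ge0 => j _; rewrite -expr2 sqr_ge0.
Qed.

Lemma enorm_eq0 u : enorm u = 0 -> u = 0.
Proof.
move=> u0; apply/rowP => i; rewrite mxE; apply/eqP; rewrite -normr_eq0.
by rewrite eq_le normr_ge0 andbT -u0 ler_coord_enorm.
Qed.

Lemma enormZ a u : enorm (a *: u) = `|a| * enorm u.
Proof.
rewrite /enorm (_ : edot _ _ = a ^+ 2 * edot u u).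
  by rewrite sqrtrM ?sqr_ge0// sqrtr_sqr.
by rewrite /edot mulr_sumr; apply: eq_bigr => i _; rewrite !mxE; ring.
Qed.

Lemma enorm0 : enorm (0 : 'rV[R]_n) = 0.
Proof. by rewrite -[0](scale0r 0) enormZ normr0 mul0r. Qed.

Lemma enormN u : enorm (- u) = enorm u.
Proof. by rewrite -scaleN1r enormZ normrN normr1 mul1r. Qed.

Lemma edot_le_enorm u v : edot u v <= enorm u * enorm v.
Proof.
have [/enorm_eq0 ->|u0] := eqVneq (enorm u) 0.
  by rewrite enorm0 mul0r /edot big1// => i _; rewrite mxE mul0r.
have [/enorm_eq0 ->|v0] := eqVneq (enorm v) 0.
  by rewrite enorm0 mulr0 /edot big1// => i _; rewrite mxE mulr0.
(* Expanded, this sum is 2 |u|^2 |v|^2 - 2 |u| |v| (u . v). The zero vectors were set aside so that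
   2 |u| |v| can be cancelled. *)
have : 0 <= \sum_i (enorm v * u ord0 i - enorm u * v ord0 i) ^+ 2.
  by apply: sumr_ge0 => i _; rewrite sqr_ge0.
rewrite (_ : \sum_i _ = enorm v ^+ 2 * edot u u + enorm u ^+ 2 * edot v v
    - 2 * (enorm u * enorm v) * edot u v); last first.
  rewrite /edot !mulr_sumr -big_split -sumrB/=; apply: eq_bigr => i _; ring.
rewrite -!sqr_enorm.
have : 0 < enorm u by rewrite lt_neqAle eq_sym u0 enorm_ge0.
have : 0 < enorm v by rewrite lt_neqAle eq_sym v0 enorm_ge0.
move=> v1 u1 h; have uv : 0 < 2 * (enorm u * enorm v) by rewrite !mulr_gt0.
rewrite -(ler_pM2l uv); move: h.
set a := enorm u; set b := enorm v; set c := edot u v; nra.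
Qed.

Lemma ler_enormD u v : enorm (u + v) <= enorm u + enorm v.
Proof.
rewrite -ler_sqr ?nnegrE ?addr_ge0 ?enorm_ge0// sqr_enorm sqrrD !sqr_enorm.
rewrite -[X in edot X _]scale1r -[X in 1 *: X]/(u + v).
have -> : edot (1 *: (u + v)) (u + v) = edot u u + edot u v *+ 2 + edot v v.
  rewrite scale1r /edot -sumrMnl -!big_split/=; apply: eq_bigr => i _.
  by rewrite !mxE; ring.
by rewrite lerD2r lerD2l lerMn2r edot_le_enorm.
Qed.

Lemma normr_edot_le u v : `|edot u v| <= enorm u * enorm v.
Proof.
rewrite ler_norml edot_le_enorm andbT lerNl -(enormN u).
rewrite (_ : - edot u v = edot (- u) v) ?edot_le_enorm//.
by rewrite /edot -sumrN; apply: eq_bigr => i _; rewrite mxE mulNr.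
Qed.

(** Adding one coordinate at a time, the square of the sum exceeds the sum of the squares by a
    nonnegative double product. Bounds on vector fields are deduced from bounds on their components
    through this. *)
Lemma enorm_le_sum u : enorm u <= \sum_i `|u ord0 i|.
Proof.
rewrite -ler_sqr ?nnegrE ?enorm_ge0 ?sumr_ge0// sqr_enorm /edot.
elim: (index_enum 'I_n) => [|i s ih]; first by rewrite !big_nil expr0n.
rewrite !big_cons sqrrD -expr2 real_normK ?num_real// -addrA lerD2l.
by apply: le_trans ih _; rewrite lerDr mulrn_wge0// mulr_ge0// sumr_ge0.
Qed.

Lemma ler_enorm_coord u (e : R) : (forall i, `|u ord0 i| <= e) -> enorm u <= n%:R * e.
Proof.
move=> ue; apply: le_trans (enorm_le_sum u) _.
apply: le_trans (_ : \sum_(i < n) e <= _); first by apply: ler_sum => i _.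
by rewrite sumr_const card_ord mulr_natl.
Qed.

End euclidean_norm.

(** * Lengths of paths and the distance inside the domain *)

Section path_lengths.
Context (R : realType) (n : nat).
Implicit Types (Omega : set 'rV[R]_n) (x y z v w : 'rV[R]_n) (p : R -> 'rV[R]_n).

(** Polygonal sums in recursive form, with a free starting parameter so that inductions on the
    partition go through. *)
Fixpoint polygonal p (a : R) (s : seq R) : R :=
  if s is b :: s' then enorm (p b - p a) + polygonal p b s' else 0.

Lemma polygonal_sum_inT p s : polygonal_sum_in setT p s = polygonal p 0 s.
Proof.
rewrite /polygonal_sum_in.
under eq_bigl do rewrite (_ : `[< _ >] = true) ?asboolT//.
have gen a : \sum_(0 <= i < size s)
    enorm (p (nth 1 (a :: s) i.+1) - p (nth 1 (a :: s) i)) = polygonal p a s.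
  elim: s a => [|b s ih] a; first by rewrite /= big_geq.
  by rewrite /= big_nat_recl//= -ih.
exact: gen.
Qed.

Lemma polygonal_ge0 p a s : 0 <= polygonal p a s.
Proof. by elim: s a => //= b s ih a; rewrite addr_ge0 ?enorm_ge0. Qed.

(** A reparametrization that stays constant for a while sends a strict partition to one with
    repetitions. Repeated points contribute segments of length 0 and are removed. *)
Lemma polygonal_weak p (phi : R -> R) a s :
  path <=%R (phi a) [seq phi t | t <- s] ->
  exists s', [/\ path <%R (phi a) s', last (phi a) s' = phi (last a s) &
    polygonal p (phi a) s' = polygonal (p \o phi) a s].
Proof.
elim: s a => [|b s ih] a /=; first by exists [::].
move=> /andP[ab /ih[s' [ps' ls' es']]].
have [eab|nab] := eqVneq (phi a) (phi b).
  by exists s'; rewrite eab; split => //; rewrite subrr enorm0 add0r.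
exists (phi b :: s'); split => //=; last by rewrite es'.
by rewrite ps' andbT lt_neqAle nab.
Qed.

Lemma polygonal_le_path_length p (phi : R -> R) s :
  itv_partition 0 1 s -> phi 0 = 0 -> phi 1 = 1 ->
  {homo phi : a b / a <= b} ->
  ((polygonal (p \o phi) 0 s)%:E <= path_length p)%E.
Proof.
move=> [ps /eqP ls] phi0 phi1 phih.
have [|s' [ps' ls' <-]] := @polygonal_weak p phi 0 s.
  by rewrite path_map; apply: sub_path ps => a b /= /ltW /phih.
apply: ereal_sup_ubound; exists s'; last by rewrite polygonal_sum_inT phi0.
by split; [rewrite -phi0|rewrite -{1}phi0 ls' ls phi1].
Qed.

(* A path along which p is run in a first or last part of the parameter
   interval, and a segment in the remaining part, is of this form. *)
Definition spliced_path p (phi psi : R -> R) v w : R -> 'rV[R]_n :=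
  fun t => p (phi t) + (v + psi t *: w).

Lemma polygonal_spliced p (phi psi : R -> R) v w a s :
  {homo psi : a b / a <= b} -> path <%R a s ->
  polygonal (spliced_path p phi psi v w) a s <=
  polygonal (p \o phi) a s + (psi (last a s) - psi a) * enorm w.
Proof.
move=> psih; elim: s a => [|b s ih] a /=; first by rewrite subrr mul0r addr0.
move=> /andP[/ltW /psih ab /ih]; set P := polygonal _ _ _; set Q := polygonal _ _ _.
have : enorm (spliced_path p phi psi v w b - spliced_path p phi psi v w a) <=
    enorm (p (phi b) - p (phi a)) + (psi b - psi a) * enorm w.
  rewrite -[X in X * enorm w]ger0_norm ?subr_ge0// -enormZ.
  rewrite (_ : _ - _ = (p (phi b) - p (phi a)) + (psi b - psi a) *: w) ?ler_enormD//.
  by rewrite /spliced_path; apply/rowP => i; rewrite !mxE; ring.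
lra.
Qed.

(** A concatenation is written here as the sum of a reparametrized path and a moving translation, so
    that continuity and length follow from the summands without gluing at the junction. That the
    result stays in [Omega] depends on the position of the segment and is left to each use. *)
Lemma dist_in_spliced Omega p (phi psi : R -> R) v w y x y' x' :
  [/\ is_path p, rectifiable p, forall t, 0 <= t <= 1 -> Omega (p t),
      p 0 = y & p 1 = x] ->
  continuous phi -> continuous psi ->
  {homo phi : a b / a <= b} -> {homo psi : a b / a <= b} ->
  phi 0 = 0 -> phi 1 = 1 -> psi 0 = 0 -> psi 1 = 1 ->
  y' = y + v -> x' = x + (v + w) ->
  (forall t, 0 <= t <= 1 -> Omega (spliced_path p phi psi v w t)) ->
  (dist_in Omega y' x' <= path_length p + (enorm w)%:E)%E.
Proof.
move=> [cp rp Op p0 p1] cphi cpsi hphi hpsi phi0 phi1 psi0 psi1 y'E x'E OP.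
set P := spliced_path p phi psi v w.
have len : (path_length P <= path_length p + (enorm w)%:E)%E.
  apply: ge_ereal_sup => _ [s sP <-]; rewrite polygonal_sum_inT.
  apply: le_trans (_ : ((polygonal (p \o phi) 0 s)%:E + (enorm w)%:E <= _)%E).
    have /eqP ls := sP.2.
    rewrite -EFinD lee_fin; apply: le_trans (polygonal_spliced _ _ _ _ hpsi sP.1) _.
    by rewrite ls psi1 psi0 subr0 mul1r.
  by rewrite leeD2r//; exact: polygonal_le_path_length.
apply: (le_trans _ len); apply: ereal_inf_lbound; exists P => //; split.
- apply/subspace_continuousP => t t01.
  rewrite /P /spliced_path; apply: cvgD; last first.
    apply: cvg_within_filter; apply: cvgD; first exact: cvg_cst.
    by apply: cvgZl; exact: cpsi.
  move/subspace_continuousP : cp => /(_ (phi t)) cp.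
  have phi01 u : `[0, 1]%classic u -> `[0, 1]%classic (phi u).
    rewrite /= !in_itv/= => /andP[u0 u1]; apply/andP.
    by split; [rewrite -phi0|rewrite -phi1]; exact: hphi.
  apply: cvg_trans (cp (phi01 _ t01)) => W /= WP.
  have near_phi : nbhs t (fun u => `[0, 1]%classic (phi u) -> W (p (phi u))).
    exact: cphi t _ WP.
  suff : nbhs t (fun u => `[0, 1]%classic u -> W (p (phi u))) by [].
  by apply: filterS near_phi => u h u01; apply: h; exact: phi01.
- by apply: le_lt_trans len _; rewrite lte_add_pinfty// ltry.
- exact: OP.
- by rewrite /P /spliced_path phi0 p0 psi0 scale0r addr0 y'E.
- by rewrite /P /spliced_path phi1 p1 psi1 scale1r x'E.
Qed.

Let min_reparam : [/\ continuous (fun t : R => Num.min (2 * t) 1),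
  {homo (fun t : R => Num.min (2 * t) 1) : a b / a <= b},
  Num.min (2 * 0) 1 = 0 :> R & Num.min (2 * 1) 1 = 1 :> R].
Proof.
split.
- move=> t; apply: continuous_min; last exact: cvg_cst.
  by apply: cvgM; [exact: cvg_cst|exact: cvg_id].
- by move=> a b ab; rewrite le_min !ge_min ler_pM2l// ab/= lexx orbT.
- by rewrite mulr0 min_l.
- by rewrite mulr1 min_r// ler1n.
Qed.

Let max_reparam : [/\ continuous (fun t : R => Num.max (2 * t - 1) 0),
  {homo (fun t : R => Num.max (2 * t - 1) 0) : a b / a <= b},
  Num.max (2 * 0 - 1) 0 = 0 :> R & Num.max (2 * 1 - 1) 0 = 1 :> R].
Proof.
split.
- have -> : (fun t : R => Num.max (2 * t - 1) 0) =
      (fun t : R => 2 * t - Num.min (2 * t) 1).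
    by apply/funext => t; case: leP => ?; case: leP => ?; lra.
  have [cmin _ _ _] := min_reparam.
  move=> t; apply: cvgB; last exact: cmin.
  by apply: cvgM; [exact: cvg_cst|exact: cvg_id].
- move=> a b ab; rewrite ge_max !le_max lexx orbT andbT.
  by rewrite lerD2r ler_pM2l// ab.
- by rewrite mulr0 max_r//; lra.
- by rewrite mulr1 max_l; lra.
Qed.

Lemma dist_in_move_end Omega y x x' :
  (forall t, 0 <= t <= 1 -> Omega (x + t *: (x' - x))) ->
  (dist_in Omega y x' <= dist_in Omega y x + (enorm (x' - x))%:E)%E.
Proof.
move=> seg; rewrite -leeBlDr//; apply: le_ereal_inf_tmp => _ [p pP <-].
rewrite leeBlDr//; have [_ _ Op _ p1] := pP.
have [cmin hmin min0 min1] := min_reparam.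
have [cmax hmax max0 max1] := max_reparam.
(* On [0, 1/2] the path [p] is run while the translation rests at 0; on [1/2, 1] the segment is run
   from the end of [p]. *)
apply: (dist_in_spliced pP cmin cmax hmin hmax (v := 0)) => //.
- by rewrite addr0.
- by rewrite add0r addrC subrK.
move=> t t01; rewrite /spliced_path add0r.
have [t2|t2] := leP (2 * t) 1.
  by rewrite max_r ?scale0r ?addr0; [apply: Op; lra|lra].
by rewrite p1; apply: seg; rewrite le_max ge_max lexx orbT ler01 andbT/=; lra.
Qed.

Lemma dist_in_move_start Omega y y' x :
  (forall t, 0 <= t <= 1 -> Omega (y' + t *: (y - y'))) ->
  (dist_in Omega y' x <= dist_in Omega y x + (enorm (y - y'))%:E)%E.
Proof.
move=> seg; rewrite -leeBlDr//; apply: le_ereal_inf_tmp => _ [p pP <-].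
rewrite leeBlDr//; have [_ _ Op p0 _] := pP.
have [cmin hmin min0 min1] := min_reparam.
have [cmax hmax max0 max1] := max_reparam.
(* The translation starts at [y' - y] and decreases to 0 on [0, 1/2] while [p] rests at [y], which
   draws the segment from [y'] to [y]; then [p] itself is run. *)
apply: (dist_in_spliced pP cmax cmin hmax hmin (v := y' - y)) => //.
- by rewrite addrC subrK.
- by rewrite subrKA subrr addr0.
move=> t t01; rewrite /spliced_path.
have [t2|t2] := leP (2 * t - 1) 0.
  rewrite p0 (_ : y + _ = y' + Num.min (2 * t) 1 *: (y - y')); last first.
    by apply/rowP => i; rewrite !mxE; ring.
  apply: seg.
  by rewrite le_min ge_min lexx orbT ler01 !andbT; lra.
rewrite min_r; last by lra.
by rewrite scale1r addrC addrA subrK subrr add0r; apply: Op; lra.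
Qed.

Lemma dist_in_refl Omega x : Omega x -> dist_in Omega x x = 0%E.
Proof.
move=> Ox; apply/eqP; rewrite eq_le; apply/andP; split; last first.
  apply: le_ereal_inf_tmp => _ [p _ <-].
  apply: le_trans (_ : (polygonal_sum_in setT p [:: 1])%:E <= _)%E.
    by rewrite lee_fin polygonal_sum_inT polygonal_ge0.
  by apply: ereal_sup_ubound; exists [:: 1] => //; split; rewrite /= ?ltr01.
have len : path_length (cst x) = 0%E.
  apply/eqP; rewrite eq_le; apply/andP; split.
    apply: ge_ereal_sup => _ [s _ <-]; rewrite polygonal_sum_inT lee_fin.
    have gen (a : R) : polygonal (cst x) a s = 0.
      by elim: s a => //= b s ih a; rewrite subrr enorm0 add0r.
    by rewrite gen.
  apply: ereal_sup_ubound; exists [:: 1]; first by split; rewrite /= ?ltr01.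
  by rewrite polygonal_sum_inT /= subrr enorm0 addr0.
apply: ereal_inf_lbound; exists (cst x) => //; split => //.
- by apply: continuous_subspaceT => t; exact: cvg_cst.
- by rewrite /rectifiable len.
Qed.

Lemma path_dist_in_move Omega p x x' :
  (forall t, 0 <= t <= 1 -> Omega (x + t *: (x' - x))) ->
  (path_dist_in Omega p x' <= path_dist_in Omega p x + (enorm (x' - x))%:E)%E.
Proof.
move=> seg; rewrite -leeBlDr//; apply: le_ereal_inf_tmp => _ [t t01 <-].
rewrite leeBlDr//; apply: le_trans (dist_in_move_end _ seg).
by apply: ereal_inf_lbound; exists t.
Qed.

End path_lengths.

(** * Measurability and positivity of the weight *)

Section domain_weight.
Context (R : realType) (n : nat) (Omega : set 'rV[R]_n).
Context (oOmega : open Omega).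
Implicit Types (x y z : 'rV[R]_n).

Lemma open_segment x : Omega x -> exists2 r : R, 0 < r & forall x',
  (forall i, `|x ord0 i - x' ord0 i| < r) ->
  Omega x' /\ forall t, 0 <= t <= 1 -> Omega (x + t *: (x' - x)) /\
                                     Omega (x' + t *: (x - x')).
Proof.
move=> Ox.
have [r r0 rO] := (rV_nbhsP x Omega).1 (open_nbhs_nbhs (conj oOmega Ox)).
exists r => // x' xx'; split=> [|t t01]; first exact: rO.
have small s i : 0 <= s <= 1 -> `|s * (x ord0 i - x' ord0 i)| < r.
  move=> /andP[s0 s1]; rewrite normrM ger0_norm//.
  by apply: le_lt_trans (xx' i); rewrite ler_piMl.
split; apply: rO => i; rewrite !mxE.
  rewrite (_ : _ - _ = t * (x ord0 i - x' ord0 i)); last by ring.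
  exact: small.
rewrite (_ : _ - _ = (1 - t) * (x ord0 i - x' ord0 i)); last by ring.
by apply: small; lra.
Qed.

Lemma enorm_small (e : R) : 0 < e -> exists2 r : R, 0 < r &
  forall u : 'rV[R]_n, (forall i, `|u ord0 i| < r) -> enorm u < e.
Proof.
(* Dividing by n + 1 makes the final bound n e / (n + 1) strictly less than e, for n = 0 too. *)
move=> e0; exists (e / n.+1%:R) => [|u ur]; first by rewrite divr_gt0.
apply: le_lt_trans (ler_enorm_coord (fun i => ltW (ur i))) _.
by rewrite mulrCA gtr_pMr// ltr_pdivrMr// mul1r ltr_nat.
Qed.

Lemma near_enorm x (e : R) : 0 < e -> \forall x' \near x, enorm (x' - x) < e.
Proof.
move=> /enorm_small[r r0 rP]; apply/rV_nbhsP; exists r => // x' xx'.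
by apply: rP => i; rewrite !mxE distrC.
Qed.

Lemma near_segment x : Omega x -> \forall x' \near x,
  Omega x' /\ forall t, 0 <= t <= 1 -> Omega (x + t *: (x' - x)) /\
                                     Omega (x' + t *: (x - x')).
Proof. by move=> /open_segment[r r0 rP]; apply/rV_nbhsP; exists r. Qed.

(** Prefixing a short segment to a path adds at most its length to the distance, so a strict bound
    persists at nearby starting points. *)
Lemma dist_in_lt_open x (c : R) :
  open [set z | Omega z /\ (dist_in Omega z x < c%:E)%E].
Proof.
rewrite openE => z [Oz zc]; rewrite /interior.
have [e e0 ec] : exists2 e : R, 0 < e &
    forall s, s < e -> (dist_in Omega z x + s%:E < c%:E)%E.
  move: zc; case: (dist_in Omega z x) => [a| |].
  - rewrite lte_fin => ac; exists (c - a) => [|s]; first by rewrite subr_gt0.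
    by rewrite -EFinD lte_fin ltrBrDl.
  - by rewrite ltNge leey.
  - by move=> _; exists 1 => // s _; rewrite ltNyr.
apply: filterS2 (near_segment Oz) (near_enorm z e0) => z' [Oz' seg] zz'.
split => //.
apply: le_lt_trans (dist_in_move_start x (fun t t01 => (seg t t01).2)) _.
by apply: ec; rewrite -enormN opprB.
Qed.

Lemma rat_in_unit_itv_near (t : R) (P : set R) : 0 <= t <= 1 -> nbhs t P ->
  exists q : rat, 0 <= (ratr q : R) <= 1 /\ P (ratr q).
Proof.
move=> t01 /nbhs_ballP[e /= e0 eP].
(* The rational is sought to the right of [t], except at [t = 1], where only the left side lies in
   [0, 1]. *)
have [t1|t1] := ltP t 1.
  have [|q] := @rat_in_itvoo R t (Num.min (t + e) 1).
    by rewrite lt_min t1 ltrDl e0.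
  rewrite in_itv/= lt_min => qP; exists q; split; first by lra.
  by apply: eP; rewrite /ball/= ltr_norml; lra.
have [|q] := @rat_in_itvoo R (Num.max (t - e) 0) t.
  by rewrite gt_max; lra.
rewrite in_itv/= gt_max => qP; exists q; split; first by lra.
by apply: eP; rewrite /ball/= ltr_norml; lra.
Qed.

(** The distance to a path is an infimum over uncountably many parameters. The strict inequality
    means that the path meets the open set [B]; by continuity it then does so at a rational
    parameter, and the set is a countable union of preimages of [B] under sections of the jointly
    measurable map [gamma]. *)
Lemma measurable_path_dist_lt (gamma : R -> 'rV[R]_n -> 'rV[R]_n) x (c : R) :
  (forall y, Omega y -> is_path (gamma^~ y)) ->
  (forall y t, Omega y -> 0 <= t <= 1 -> Omega (gamma t y)) ->
  (forall i : 'I_n, measurable_fun (`[0, 1] `*` Omega : set (R * Rn R n))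
    (fun ty => gamma ty.1 ty.2 ord0 i)) ->
  measurable ([set y | Omega y /\
    (path_dist_in Omega (gamma^~ y) x < c%:E)%E] : set (Rn R n)).
Proof.
move=> gpath gin gmeas.
pose B := [set z | Omega z /\ (dist_in Omega z x < c%:E)%E].
have oB : open B by exact: dist_in_lt_open.
have mO : measurable (Omega : set (Rn R n)) by exact: measurable_rV_open.
pose F (q : rat) : set (Rn R n) :=
  if 0 <= (ratr q : R) <= 1 then Omega `&` gamma (ratr q) @^-1` B else set0.
rewrite (_ : [set y | _] = \bigcup_q F q).
  apply: countable_bigcupT_measurable; first exact: countableP.
  move=> q; rewrite /F; case: ifPn => // q01.
  have mF : measurable (`[0, 1] `*` Omega : set (R * Rn R n)) by exact: measurableX.
  have mp : measurable_fun (Omega : set (Rn R n))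
      (fun y : Rn R n => (ratr q : R, y)).
    exact: measurable_funTS (pair1_measurable _).
  have sub : (fun y : Rn R n => (ratr q : R, y)) @` Omega `<=` `[0, 1] `*` Omega.
    by move=> _ [y Oy <-]; split=> //=; rewrite in_itv.
  have mg i : measurable_fun (Omega : set (Rn R n))
      (fun y : Rn R n => gamma (ratr q) y ord0 i).
    have h s := measurable_comp mF s (gmeas i) mp; exact: h sub.
  exact: (@measurable_preimage_open R n _ (Rn R n) Omega (gamma (ratr q)) B mO mg oB).
apply/seteqP; split=> y.
  move=> [Oy /ereal_inf_lt[_ [t + <-]]]; rewrite /= in_itv/= => t01 yc.
  have Bt : B (gamma t y) by split => //; exact: gin.
  have := gpath y Oy => /subspace_continuousP/(_ t).
  rewrite /= in_itv/= => /(_ t01 _ (open_nbhs_nbhs (conj oB Bt))) nt.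
  have {}nt : nbhs t (fun u => `[0, 1]%classic u -> B (gamma u y)) by exact: nt.
  have [q [q01 Bq]] := rat_in_unit_itv_near t01 nt.
  exists q => //; rewrite /F q01; split => //=; apply: Bq.
  by rewrite /= in_itv.
move=> [q _]; rewrite /F; case: ifPn => // q01 [Oy [_ yc]]; split => //.
apply: le_lt_trans yc; apply: ereal_inf_lbound; exists (ratr q) => //.
Qed.

Lemma bdist_le x x' : bdist Omega x' <= bdist Omega x + enorm (x' - x).
Proof.
rewrite /bdist; set B := closure Omega `\` interior Omega.
(* For an empty boundary the infimum is 0 by convention. *)
have [B0|/set0P B0] := eqVneq B set0.
  by rewrite B0 !image_set0 inf0 add0r enorm_ge0.
rewrite -lerBlDr; apply: lb_le_inf; first exact: image_nonempty.
move=> _ [z Bz <-]; rewrite lerBlDr.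
apply: le_trans (_ : enorm (x' - z) <= _).
  apply: ge_inf; last by exists z.
  by exists 0 => _ [? _ <-]; exact: enorm_ge0.
have -> : x' - z = (x - z) + (x' - x) by apply/rowP => i; rewrite !mxE; ring.
exact: ler_enormD.
Qed.

Lemma bdist_ge0 x : 0 <= bdist Omega x.
Proof.
rewrite /bdist; set B := closure Omega `\` interior Omega.
have [B0|/set0P B0] := eqVneq B set0; first by rewrite B0 image_set0 inf0.
apply: lb_le_inf; first exact: image_nonempty.
by move=> _ [z _ <-]; exact: enorm_ge0.
Qed.

Lemma measurable_usc (f : 'rV[R]_n -> \bar R) :
  (forall x a, Omega x -> (f x < a)%E -> \forall x' \near x, (f x' < a)%E) ->
  measurable_fun (Omega : set (Rn R n)) (f : Rn R n -> \bar R).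
Proof.
move=> usc mO; apply: (measurability _ (ErealGenInftyO.measurableE R)) => //.
move=> _ [_ [a ->] <-]; apply: measurable_rV_open.
rewrite openE => x [Ox]; rewrite /= in_itv/= => fa.
apply: filterS2 (open_nbhs_nbhs (conj oOmega Ox)) (usc x _ Ox fa) => x' Ox' fx'.
by split => //=; rewrite in_itv.
Qed.

Lemma measurable_bdist :
  measurable_fun (Omega : set (Rn R n)) (bdist Omega : Rn R n -> R).
Proof.
apply/measurable_EFinP; apply: measurable_usc => x a Ox.
case: a => [a| |//]; last first.
  by move=> _; apply/rV_nbhsP; exists 1 => // x' _; rewrite ltry.
rewrite lte_fin => xa.
have e0 : 0 < a - bdist Omega x by rewrite subr_gt0.
apply: filterS (near_enorm x e0) => x' xx'; rewrite lte_fin.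
by apply: le_lt_trans (bdist_le x x') _; rewrite addrC -ltrBrDr.
Qed.

Context (bO : bounded_set Omega) (x0 : 'rV[R]_n) (Cn : R).
Context (gamma : R -> 'rV[R]_n -> 'rV[R]_n) (fam : path_family Cn Omega x0 gamma).

Let mO : measurable (Omega : set (Rn R n)).
Proof. exact: measurable_rV_open. Qed.

Let muO : (lebesgue (Omega : set (Rn R n)) < +oo)%E.
Proof. exact: lebesgue_outer_bounded. Qed.

Lemma omega_lt_pinfty x : (omega Omega gamma x < +oo)%E.
Proof.
by apply: le_lt_trans muO; apply: le_lebesgue_outer => y [].
Qed.

Lemma omega_ge0 x : (0 <= omega Omega gamma x)%E.
Proof. exact: lebesgue_outer_ge0. Qed.

(** The sets [F k], defined by a strict inequality with the slack 1/(k+1), decrease to the set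
    measured by [omega x]. They lie in [Omega], of finite measure, so continuity from above makes
    one of them of measure less than [a], and for [x'] close to [x] it contains the set measured at
    [x']. *)
Lemma omega_usc x (a : \bar R) : Omega x -> (omega Omega gamma x < a)%E ->
  \forall x' \near x, (omega Omega gamma x' < a)%E.
Proof.
move=> Ox xa.
pose F (k : nat) : set (Rn R n) := [set y | Omega y /\
  (path_dist_in Omega (gamma^~ y) x < (bdist Omega x / 2 + k.+1%:R^-1)%:E)%E].
have mF k : measurable (F k).
  apply: measurable_path_dist_lt.
  - exact: path_continuous fam.
  - exact: path_in fam.
  - exact: path_measurable fam.
have FE : \bigcap_k F k = [set y | Omega y /\
    (path_dist_in Omega (gamma^~ y) x <= (bdist Omega x / 2)%:E)%E].
  apply/seteqP; split=> y.
    move=> Fy; split; first by have [] := Fy 0 I.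
    apply/lee_addgt0Pr => e e0.
    have [_ /ltW] := Fy (Num.truncn e^-1) I.
    move=> /le_trans; apply; rewrite -EFinD lee_fin lerD2l.
    by rewrite invf_ple ?posrE//; exact: ltW (truncnS_gt _).
  move=> [Oy yx] k _; split => //; apply: le_lt_trans yx _.
  by rewrite lte_fin ltrDl invr_gt0.
have : (@lebesgue R n \o F) k @[k --> \oo] --> omega Omega gamma x.
  rewrite /omega -FE; apply: nonincreasing_cvg_mu => //.
  - by apply: le_lt_trans muO; apply: le_lebesgue_outer => y [].
  - by apply: bigcapT_measurable.
  - move=> i j ij; apply/subsetPset => y [Oy yj]; split => //.
    apply: lt_le_trans yj _; rewrite lee_fin lerD2l lef_pV2 ?posrE// ler_nat.
    by rewrite ltnS.
move=> cvgF.
have [k Fa] : exists k, (@lebesgue R n (F k) < a)%E.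
  apply: contrapT => /forallNP nF; move: xa; rewrite ltNge => /negP; apply.
  rewrite -(cvg_lim _ cvgF)//; apply: lime_ge.
    by apply/cvg_ex; exists (omega Omega gamma x).
  by apply: nearW => k; rewrite leNgt; apply/negP; exact: nF.
(* Moving from [x'] to [x] costs |x - x'| in the distance to the path and half of it in
   [bdist Omega x' / 2]. The total, 3/2 |x - x'|, is below 1/(k+1) within this radius. *)
have e0 : 0 < k.+1%:R^-1 / 2 :> R by rewrite divr_gt0.
apply: filterS2 (near_segment Ox) (near_enorm x e0) => x' [_ seg] xx'.
apply: le_lt_trans Fa; apply: le_lebesgue_outer => y [Oy yx']; split => //.
apply: le_lt_trans (path_dist_in_move (x := x') _ _) _.
  by move=> t t01; exact: (seg t t01).2.
apply: (@le_lt_trans _ _ ((bdist Omega x' / 2)%:E + (enorm (x - x'))%:E)%E).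
  exact: leeD2r.
rewrite -EFinD lte_fin -(enormN (x - x')) opprB.
move: e0 xx' (bdist_le x x').
move: k.+1%:R^-1 (enorm _) (bdist _ _) (bdist _ _) => K e b b'; lra.
Qed.

Lemma measurable_weight :
  measurable_fun (Omega : set (Rn R n)) (weight Omega gamma : Rn R n -> R).
Proof.
apply: measurable_funM.
  apply: (measurableT_comp (fine_measurable measurableT)).
  exact: measurable_usc omega_usc.
(* The inverse is replaced by the power -1, with which it agrees on nonnegative reals. *)
rewrite (_ : (fun x => _) = (fun x : Rn R n => (bdist Omega x ^+ n.-1) `^ (-1))).
  apply: (measurableT_comp (measurable_powR _)).
  by apply: measurable_funX; exact: measurable_bdist.
by apply/funext => x; rewrite powR_inv1// exprn_ge0// bdist_ge0.
Qed.

Lemma weight_ge0 x : 0 <= weight Omega gamma x.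
Proof.
by rewrite divr_ge0 ?exprn_ge0 ?bdist_ge0// fine_ge0// omega_ge0.
Qed.

(** Otherwise [Omega] would be open and closed, and so would its preimage under a line through [x];
    the real line being connected, [Omega] would contain the whole line, against boundedness. *)
Lemma boundary_nonempty x : (0 < n)%N -> Omega x ->
  (closure Omega `\` interior Omega) !=set0.
Proof.
move=> n0 Ox; apply/set0P/negP => /eqP noB.
have cO : closed Omega.
  move=> z cz; apply: contrapT => nz.
  have : (closure Omega `\` interior Omega) z.
    by split => //; move/interior_id : oOmega => ->.
  by rewrite noB.
pose v : 'rV[R]_n := const_mx 1.
pose L (t : R) := x + t *: v.
have cL : continuous L.
  by move=> t; apply: cvgD; [exact: cvg_cst|apply: cvgZl; exact: cvg_id].
have LO : L @^-1` Omega = setT.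
  have /connected_intervalP cR : is_interval [set: R] by [].
  apply: cR.
  - by exists 0; rewrite /L /= scale0r addr0.
  - exists (L @^-1` Omega); last by rewrite setTI.
    exact: open_comp.
  - exists (L @^-1` Omega); last by rewrite setTI.
    by apply: preimage_closed.
have [M [_ MO]] := bO.
have := MO (`|M| + 1); rewrite (le_lt_trans (ler_norm _)) ?ltrDl//.
move=> /(_ isT) MO1.
pose i0 := Ordinal n0.
(* At this parameter the coordinate [i0] of the point on the line is at least |M| + 2, beyond the
   bound |M| + 1 on [Omega]. *)
have : Omega (L (`|M| + 2 + `|x ord0 i0|)).
  by have : setT (`|M| + 2 + `|x ord0 i0|) by []; rewrite -LO.
move=> /MO1 /= /(le_trans (ler_coord_norm _ i0)); rewrite !mxE mulr1.
have := ler_norm (x ord0 i0 + (`|M| + 2 + `|x ord0 i0|)).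
have := ler_norm (- x ord0 i0); rewrite normrN; lra.
Qed.

Lemma bdist_gt0 x : (0 < n)%N -> Omega x -> 0 < bdist Omega x.
Proof.
move=> n0 Ox.
have [r r0 rO] := (rV_nbhsP x Omega).1 (open_nbhs_nbhs (conj oOmega Ox)).
apply: lt_le_trans r0 _; apply: lb_le_inf.
  exact: image_nonempty (boundary_nonempty n0 Ox).
move=> _ [z [_ nz] <-]; rewrite leNgt; apply/negP => xz; apply: nz.
move/interior_id : oOmega => ->; apply: rO => i.
by apply: le_lt_trans xz; have := ler_coord_enorm (x - z) i; rewrite !mxE.
Qed.

(** The hypothesis on [A] says that the measure is not identically 0. Were [omega] zero at [x], the
    nonempty open set [interior U] would be null, and with it every set, [A] included. *)
Lemma omega_gt0 x : (0 < n)%N -> Omega x ->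
  (exists A : set 'rV[R]_n, lebesgue_outer A <> 0%E) -> (0 < omega Omega gamma x)%E.
Proof.
move=> n0 Ox [A muA]; have d0 := bdist_gt0 n0 Ox.
rewrite lt_neqAle omega_ge0 andbT; apply/eqP => om0; apply: muA.
have d20 : 0 < bdist Omega x / 2 by rewrite divr_gt0.
pose U := [set x' | (Omega x' /\
    forall t, 0 <= t <= 1 -> Omega (x + t *: (x' - x)) /\
                            Omega (x' + t *: (x - x'))) /\
    enorm (x' - x) < bdist Omega x / 2].
have Ux : interior U x by exact: filterI (near_segment Ox) (near_enorm x d20).
apply: (@open_null_lebesgue_outer_eq0 _ _ (interior U)).
- exact: open_interior.
- by exists x.
apply/eqP; rewrite eq_le lebesgue_outer_ge0 andbT [leRHS]om0.
apply: le_lebesgue_outer => y /interior_subset[[Oy seg] yx]; split => //.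
apply: le_trans (_ : (dist_in Omega y x <= _)%E).
  apply: ereal_inf_lbound; exists 0; first by rewrite /= in_itv/= lexx ler01.
  by rewrite (path_start fam).
apply: le_trans (dist_in_move_start x (y := x) _) _.
  by move=> t t01; exact: (seg t t01).2.
by rewrite dist_in_refl// add0e lee_fin -enormN opprB ltW.
Qed.

Lemma weight_gt0 x : (0 < n)%N -> Omega x ->
  (exists A : set 'rV[R]_n, lebesgue_outer A <> 0%E) -> 0 < weight Omega gamma x.
Proof.
move=> n0 Ox muA; rewrite divr_gt0 ?exprn_gt0 ?bdist_gt0//.
by rewrite fine_gt0// omega_gt0// omega_lt_pinfty.
Qed.

End domain_weight.

(** * Duality of Lebesgue spaces *)

Section hahn_banach.
Context (R : realType) (V : lmodType R) (N : V -> R).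
Context (N_sub : forall v w, N (v + w) <= N v + N w).
Context (N_hom : forall (a : R) v, 0 < a -> N (a *: v) = a * N v).

(** A partial linear functional is encoded by its graph, so that extension is inclusion and chains
    have their unions as upper bounds. *)
Definition dominated_graph (G : set (V * R)) : Prop :=
  (forall a x y, G x -> G y -> G (a *: x.1 + y.1, a * x.2 + y.2)) /\
  (forall x, G x -> x.2 <= N x.1).

Let N0 : N 0 = 0.
Proof. have := @N_hom 2 0 (ltr0n _ 2); rewrite scaler0; lra. Qed.

(** The differences [r - s] and [s - r] are both values over 0, hence at most [N 0], which is 0. *)
Lemma dominated_graph_functional G v r s :
  dominated_graph G -> G (v, r) -> G (v, s) -> r = s.
Proof.
move=> [linG domG] Gr Gs; apply/eqP; rewrite eq_le.
have := domG _ (linG (-1) _ _ Gr Gs); have := domG _ (linG (-1) _ _ Gs Gr).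
by rewrite /= scaleN1r addNr N0; lra.
Qed.

(** The value [c] at [v0] must lie above every s - N (x - v0) and below every N (y + v0) - t, for
    (x, s) and (y, t) in [G]. Subadditivity of [N] makes these requirements compatible, and the
    supremum [c] of the lower ones will do. *)
Lemma dominated_graph_extend G v0 : dominated_graph G -> G !=set0 ->
  exists2 G', dominated_graph G' & G `<=` G' /\ exists c, G' (v0, c).
Proof.
move=> [linG domG] [[u0 s0] G0].
have G00 : G (0, 0).
  have := linG (-1) _ _ G0 G0; rewrite /= scaleN1r mulN1r !addNr.
  by [].
pose S := [set x.2 - N (x.1 - v0) | x in G].
have Sle x y : G x -> G y -> x.2 - N (x.1 - v0) <= N (y.1 + v0) - y.2.
  move=> Gx Gy; have := domG _ (linG 1 _ _ Gx Gy); rewrite /= scale1r mul1r.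
  have -> : x.1 + y.1 = (x.1 - v0) + (y.1 + v0) by rewrite addrACA addNr addr0.
  by have := N_sub (x.1 - v0) (y.1 + v0); lra.
pose c := sup S.
have cub x : G x -> x.2 - N (x.1 - v0) <= c.
  move=> Gx; apply: ub_le_sup; last by exists x.
  by exists (N ((0 : V) + v0) - 0) => _ [y Gy <-]; exact: (Sle _ (0, 0)).
have clb y : G y -> c <= N (y.1 + v0) - y.2.
  move=> Gy; apply: ge_sup; first by exists (0 - N (0 - v0)), (0, 0).
  by move=> _ [x Gx <-]; exact: Sle.
exists [set x | exists y t, G y /\ x = (y.1 + t *: v0, y.2 + t * c)]; last first.
  split.
    move=> x Gx; exists x, 0.
    by rewrite scale0r mul0r !addr0 -surjective_pairing.
  by exists c, (0, 0), 1; rewrite /= scale1r mul1r !add0r.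
split.
  move=> a _ _ [x [t [Gx ->]]] [y [s [Gy ->]]].
  exists (a *: x.1 + y.1, a * x.2 + y.2), (a * t + s); split; first exact: linG.
  congr pair => /=; last by ring.
  by rewrite scalerDr scalerDl scalerA addrACA.
move=> _ [x [t [Gx ->]]] /=.
have Gs b : G (b *: x.1, b * x.2) by have := linG b _ _ Gx G00; rewrite /= !addr0.
have [t0|t0|->] := ltgtP t 0; last by rewrite scale0r mul0r !addr0; exact: domG.
- have := cub _ (Gs (- t)^-1); rewrite /= => h.
  have -> : x.1 + t *: v0 = (- t) *: ((- t)^-1 *: x.1 - v0).
    by rewrite scalerBr scalerA divff ?oppr_eq0 ?lt_eqF// scale1r scaleNr opprK.
  rewrite N_hom ?oppr_gt0//.
  have -> : x.2 = (- t) * ((- t)^-1 * x.2).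
    by rewrite mulrA divff ?oppr_eq0 ?lt_eqF// mul1r.
  by nra.
- have := clb _ (Gs t^-1); rewrite /= => h.
  have -> : x.1 + t *: v0 = t *: (t^-1 *: x.1 + v0).
    by rewrite scalerDr scalerA divff ?gt_eqF// scale1r.
  rewrite N_hom//.
  have -> : x.2 = t * (t^-1 * x.2) by rewrite mulrA divff ?gt_eqF// mul1r.
  by nra.
Qed.

Lemma hahn_banach (F : set (V * R)) : dominated_graph F -> F !=set0 ->
  exists f : V -> R, [/\ forall a v w, f (a *: v + w) = a * f v + f w,
    forall v, f v <= N v & forall x, F x -> f x.1 = x.2].
Proof.
move=> domF [z0 Fz0].
(* Zorn's lemma is applied to the sets whose union with [F] is dominated, rather than to the
   extensions of [F]: the union of the empty chain is then admissible as well. *)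
have [|A [domA maxA]] := @Zorn_bigcup _ [set G | dominated_graph (F `|` G)].
  move=> C CP totC; split.
    move=> a x y Hx Hy.
    have [X [XC Xx Xy]] : exists X, [/\ dominated_graph (F `|` X),
        F `|` X `<=` F `|` \bigcup_(Y in C) Y, (F `|` X) x & (F `|` X) y].
      have sub Z : C Z -> F `|` Z `<=` F `|` \bigcup_(Y in C) Y.
        by move=> CZ u [Fu|Zu]; [left|right; exists Z].
      case: Hx => [Fx|[X CX Xx]]; case: Hy => [Fy|[Y CY Yy]].
      - by exists set0; rewrite setU0; split=> // u; left.
      - by exists Y; split; [exact: CP|exact: sub|left|right].
      - by exists X; split; [exact: CP|exact: sub|right|left].
      - have [XY|YX] := totC _ _ CX CY.
        + by exists Y; split; [exact: CP|exact: sub|right; exact: XY|right].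
        + by exists X; split; [exact: CP|exact: sub|right|right; exact: YX].
    by move=> ?; apply: Xx; apply: XC.1.
  move=> x [Fx|[X CX Xx]]; first exact: domF.2.
  by apply: (CP _ CX).2; right.
have tot v : exists r, (F `|` A) (v, r).
  have [G' domG' [AG' [c G'c]]] :=
    dominated_graph_extend v domA (ex_intro _ z0 (or_introl Fz0)).
  apply: contrapT => nv; apply: (maxA G'); last first.
    by rewrite /= setUidr// => x Fx; apply: AG'; left.
  split; first by move=> x Ax; apply: AG'; right.
  by move=> G'A; apply: nv; exists c; right; exact: G'A.
have /choice[f fP] := tot.
exists f; split.
- move=> a v w; apply: (dominated_graph_functional domA (fP _)).
  exact: domA.1 a _ _ (fP v) (fP w).
- by move=> v; exact: domA.2 _ (fP v).
- move=> [v r] Fvr; apply: (dominated_graph_functional domA (fP _)).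
  by left.
Qed.

End hahn_banach.

(** * Norms in L^p, with infinite exponent included *)

Section Lfun_lemmas.
Context d (T : measurableType d) (R : realType) (mu : {measure set T -> \bar R}).
Implicit Types (f g : T -> R) (p : \bar R).

Lemma LfunPl p f :
  f \in Lfun mu p <->
  measurable_fun setT f /\ ('N[mu]_p[EFin \o f] < +oo)%E.
Proof.
split=> [|[mf fy]]; first by rewrite inE => /andP[/[!inE]/= ? ?].
by rewrite inE; apply/andP; split; rewrite inE.
Qed.

Lemma le_Lnorm p f g : (0 < p)%E -> measurable_fun setT f ->
  measurable_fun setT g -> (forall x, `|f x| <= `|g x|) ->
  ('N[mu]_p[EFin \o f] <= 'N[mu]_p[EFin \o g])%E.
Proof.
move=> p0 mf mg fg; rewrite unlock; case: p p0 => [r|_|//]; last first.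
  case: ifPn => // _; apply: le_ess_sup; apply: aeW => x /=.
  by rewrite lee_fin.
rewrite lte_fin => r0.
apply: gt0_ler_poweR; first by rewrite invr_ge0 ltW.
- by rewrite in_itv/= leey andbT; apply: integral_ge0 => x _; rewrite lee_fin powR_ge0.
- by rewrite in_itv/= leey andbT; apply: integral_ge0 => x _; rewrite lee_fin powR_ge0.
apply: ge0_le_integral => //.
- by move=> x _; exact: poweR_ge0.
- apply/measurable_EFinP; apply: (measurableT_comp (measurable_powR _)).
  exact: measurableT_comp.
- apply/measurable_EFinP; apply: (measurableT_comp (measurable_powR _)).
  exact: measurableT_comp.
- by move=> x _; rewrite /= lee_fin; apply: ge0_ler_powR; rewrite ?nnegrE ?(ltW r0).
Qed.

Lemma eq_Lfun p f g : f =1 g -> f \in Lfun mu p -> g \in Lfun mu p.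
Proof. by move=> /funext ->. Qed.

Lemma Lfun_lin p (a : R) f g : (1 <= p)%E -> f \in Lfun mu p ->
  g \in Lfun mu p -> (fun x => a * f x + g x) \in Lfun mu p.
Proof.
move=> p1 fp gp; have h := (Lfun_submod_closed mu p1).2 a f g fp gp.
exact: eq_Lfun h.
Qed.

Lemma Lfun_cst0 p : (1 <= p)%E -> (fun=> 0) \in Lfun mu p.
Proof. by move=> p1; have h := (Lfun_submod_closed mu p1).1; exact: eq_Lfun h. Qed.

Lemma Lfun_scaler p (a : R) f : (1 <= p)%E -> f \in Lfun mu p ->
  (fun x => a * f x) \in Lfun mu p.
Proof.
move=> p1 fp; apply: eq_Lfun (Lfun_lin a p1 fp (Lfun_cst0 p1)) => x.
by rewrite addr0.
Qed.

Lemma Lfun_add p f g : (1 <= p)%E -> f \in Lfun mu p ->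
  g \in Lfun mu p -> (fun x => f x + g x) \in Lfun mu p.
Proof.
by move=> p1 fp gp; apply: eq_Lfun (Lfun_lin 1 p1 fp gp) => x; rewrite mul1r.
Qed.

Lemma Lfun_sum p (I : Type) (s : seq I) (P : pred I) (F : I -> T -> R) :
  (1 <= p)%E -> (forall i, F i \in Lfun mu p) ->
  (fun x => \sum_(i <- s | P i) F i x) \in Lfun mu p.
Proof.
move=> p1 Fp; elim: s => [|i s ih].
  by apply: eq_Lfun (Lfun_cst0 p1) => x; rewrite big_nil.
have [Pi|Pi] := boolP (P i).
  by apply: eq_Lfun (Lfun_add p1 (Fp i) ih) => x; rewrite big_cons Pi.
by apply: eq_Lfun ih => x; rewrite big_cons (negbTE Pi).
Qed.

Lemma Lfun_le p f g : (1 <= p)%E -> measurable_fun setT f -> g \in Lfun mu p ->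
  (forall x, `|f x| <= `|g x|) -> f \in Lfun mu p.
Proof.
move=> p1 mf /LfunPl[mg gy] fg; apply/LfunPl; split => //.
by apply: le_lt_trans gy; apply: le_Lnorm => //; exact: lt_le_trans p1.
Qed.

Definition Lnormr p f : R := fine 'N[mu]_p[EFin \o f].

Lemma LnormrE p f : f \in Lfun mu p -> ('N[mu]_p[EFin \o f])%E = (Lnormr p f)%:E.
Proof.
by move=> /LfunPl[_ fy]; rewrite fineK// ge0_fin_numE// Lnorm_ge0.
Qed.

Lemma Lnormr_ge0 p f : 0 <= Lnormr p f.
Proof. by apply: fine_ge0; exact: Lnorm_ge0. Qed.

Lemma LnormrZ p (a : R) f : (1 <= p)%E -> f \in Lfun mu p ->
  Lnormr p (fun x => a * f x) = `|a| * Lnormr p f.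
Proof.
move=> p1 fp; have := LnormZ (Lfun_Sub p1 fp) a.
by rewrite /Lnormr /= => -> ; rewrite fineM// fin_numElt ?ltNyr// LnormrE// ltry ltNyr.
Qed.

Lemma Lnormr_addle p f g : (1 <= p)%E -> f \in Lfun mu p ->
  g \in Lfun mu p -> Lnormr p (fun x => f x + g x) <= Lnormr p f + Lnormr p g.
Proof.
move=> p1 fp gp; rewrite -lee_fin EFinD -!LnormrE//; last exact: Lfun_add.
by apply: eminkowski => //; [move/LfunPl: fp => []|move/LfunPl: gp => []].
Qed.

Lemma le_Lnormr p f g : (1 <= p)%E -> measurable_fun setT f ->
  g \in Lfun mu p -> (forall x, `|f x| <= `|g x|) -> Lnormr p f <= Lnormr p g.
Proof.
move=> p1 mf gp fg; rewrite -lee_fin -!LnormrE//; last exact: Lfun_le gp fg.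
apply: le_Lnorm => //; first exact: lt_le_trans p1.
by move/LfunPl: gp => [].
Qed.

Lemma Lnormr_sum p (I : Type) (s : seq I) (F : I -> T -> R) :
  (1 <= p)%E -> (forall i, F i \in Lfun mu p) ->
  Lnormr p (fun x => \sum_(i <- s) F i x) <= \sum_(i <- s) Lnormr p (F i).
Proof.
move=> p1 Fp; elim: s => [|i s ih].
  rewrite big_nil (_ : (fun x => _) = (fun=> 0)); last first.
    by apply/funext => x; rewrite big_nil.
  have := LnormrZ 0 p1 (Lfun_cst0 p1); rewrite normr0 mul0r.
  by rewrite mul0r => ->.
rewrite big_cons (_ : (fun x => _) =
  (fun x => F i x + \sum_(i <- s) F i x)); last first.
  by apply/funext => x; rewrite big_cons.
apply: le_trans (Lnormr_addle p1 (Fp i) (Lfun_sum _ _ p1 Fp)) _.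
by rewrite lerD2l.
Qed.

Lemma Lnormr_powR (r : R) f : 1 <= r -> f \in Lfun mu r%:E ->
  (\int[mu]_x (`|f x| `^ r)%:E)%E = (Lnormr r%:E f `^ r)%:E.
Proof.
move=> r1 fr; have r0 : r != 0 by rewrite gt_eqF// (lt_le_trans ltr01).
rewrite -poweR_EFin -LnormrE// poweR_Lnorm//.
Qed.

Lemma LfunP_powR (r : R) f : 1 <= r ->
  f \in Lfun mu r%:E <->
  measurable_fun setT f /\ (\int[mu]_x (`|f x| `^ r)%:E < +oo)%E.
Proof.
move=> r1; have r0 : r != 0 by rewrite gt_eqF// (lt_le_trans ltr01).
split=> [/[dup] /LfunPl[mf _] /(Lnormr_powR r1) ->|[mf fr]].
  by rewrite ltry.
apply/LfunPl; split => //; rewrite unlock.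
exact: poweR_lty fr.
Qed.

Lemma conjugate_exponentsP p (q : R) : (1 < p)%E -> 1 <= q ->
  (p^-1 + (q%:E)^-1 = 1)%E ->
  p = +oo%E /\ q = 1 \/
  exists r, [/\ p = r%:E, 1 < r, 1 < q & r^-1 + q^-1 = 1].
Proof.
move=> p1 q1; have q0 : 0 < q by exact: lt_le_trans q1.
case: p p1 => [r|_|//].
  rewrite lte_fin => r1; have r0 : 0 < r by exact: lt_trans r1.
  rewrite !inver !gt_eqF// -EFinD => -[rq]; right; exists r; split => //.
  rewrite lt_neqAle q1 andbT; apply/eqP => q1'.
  move: rq; rewrite -q1' invr1 => /(canRL (addrK _)); rewrite subrr => /eqP.
  by rewrite invr_eq0 gt_eqF.
rewrite invey add0e inver gt_eqF// => -[q1']; left; split => //.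
by rewrite -[q]invrK q1' invr1.
Qed.

Lemma hoelder_Lfun p (q : R) f g : (1 < p)%E -> 1 <= q ->
  (p^-1 + (q%:E)^-1 = 1)%E -> f \in Lfun mu p -> g \in Lfun mu q%:E ->
  ('N[mu]_1[EFin \o (f \* g)%R] <= (Lnormr p f * Lnormr q%:E g)%:E)%E.
Proof.
move=> p1 q1 pq fp gq; have /LfunPl[mf _] := fp; have /LfunPl[mg _] := gq.
have [[poo q1']|[r [pr r1 q1' rq]]] := conjugate_exponentsP p1 q1 pq; last first.
  rewrite EFinM -!LnormrE// pr; apply: hoelder => //.
  - exact: lt_trans r1.
  - exact: lt_trans q1'.
rewrite q1' in gq *; rewrite EFinM -(LnormrE gq) !Lnorm1.
have := LnormrE fp; rewrite poo {1}unlock.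
have mfg : measurable_fun setT (f \* g) by exact: measurable_funM.
(* The L^oo norm is 0 by definition when the whole space is null; the integral is 0 in that case
   too. *)
case: ifPn => [mu0 fE|mu0 _]; last first.
  have muT0 : mu setT = 0%E by apply/eqP; rewrite eq_le leNgt mu0 measure_ge0.
  rewrite null_set_integral ?mule_ge0 ?lee_fin ?Lnormr_ge0 ?integral_ge0//.
  by do 2 apply: measurableT_comp => //.
rewrite -ge0_integralZl//; last by rewrite lee_fin Lnormr_ge0.
  apply: ae_ge0_le_integral => //.
  - by do 2 apply: measurableT_comp => //.
  - by move=> x _; rewrite mule_ge0// lee_fin Lnormr_ge0.
  - by apply: measurable_funeM; do 2 apply: measurableT_comp => //.
  apply: filterS (ess_sup_ge mu (abse \o (EFin \o f))) => x /= fx _.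
  by rewrite -fE /= normrM EFinM lee_wpmul2r ?lee_fin.
by do 2 apply: measurableT_comp => //.
Qed.

Lemma integrable_hoelder p (q : R) f g : (1 < p)%E -> 1 <= q ->
  (p^-1 + (q%:E)^-1 = 1)%E -> f \in Lfun mu p -> g \in Lfun mu q%:E ->
  mu.-integrable setT (fun x => (f x * g x)%:E).
Proof.
move=> p1 q1 pq fp gq; apply/Lfun1_integrable/LfunPl; split.
  by apply: measurable_funM; [move/LfunPl: fp => []|move/LfunPl: gq => []].
by apply: le_lt_trans (hoelder_Lfun p1 q1 pq fp gq) _; exact: ltry.
Qed.

Lemma Rintegral_hoelder p (q : R) f g : (1 < p)%E -> 1 <= q ->
  (p^-1 + (q%:E)^-1 = 1)%E -> f \in Lfun mu p -> g \in Lfun mu q%:E ->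
  `|\int[mu]_x (f x * g x)| <= Lnormr p f * Lnormr q%:E g.
Proof.
move=> p1 q1 pq fp gq.
have ifg := integrable_hoelder p1 q1 pq fp gq.
apply: le_trans (le_normr_Rintegral _ ifg) _ => //.
rewrite -lee_fin; apply: le_trans (hoelder_Lfun p1 q1 pq fp gq).
rewrite Lnorm1 /Rintegral fineK; first exact: lexx.
exact: integrable_fin_num (integrable_norm ifg).
Qed.

(** Dominated convergence for q-th powers. Pointwise convergence takes the form of eventual
    vanishing, which is what the tails of a disjoint union and the remainders of truncations
    satisfy. *)
Lemma Lnormr_dominated_cvg0 (q : R) g (f_ : nat -> T -> R) : 1 <= q ->
  g \in Lfun mu q%:E -> (forall k, measurable_fun setT (f_ k)) ->
  (forall k x, `|f_ k x| <= `|g x|) ->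
  (forall x, \forall k \near \oo, f_ k x = 0) ->
  forall e : R, 0 < e -> \forall k \near \oo, Lnormr q%:E (f_ k) < e.
Proof.
move=> q1 gq mf fg f0 e e0.
have q0 : 0 < q := lt_le_trans ltr01 q1.
have fq k : f_ k \in Lfun mu q%:E by exact: Lfun_le (mf k) gq (fg k).
pose F k x := (`|f_ k x| `^ q)%:E.
have mF k : measurable_fun setT (F k).
  apply/measurable_EFinP; apply: (measurableT_comp (measurable_powR _)).
  exact: measurableT_comp.
have [|||||_ _] := @dominated_convergence _ _ _ mu setT measurableT F (cst 0%E)
  (fun x => (`|g x| `^ q)%:E).
- exact: mF.
- exact: measurable_cst.
- apply: aeW => x _; apply: cvg_near_cst.
  apply: filterS (f0 x) => k fk0.
  by rewrite /F fk0 normr0 powR0// gt_eqF.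
- exact: Lfun_integrable.
- apply: aeW => x k _; rewrite /F gee0_abs ?lee_fin ?powR_ge0//.
  by apply: ge0_ler_powR; rewrite ?nnegrE// ltW.
rewrite integral0 => /fine_cvgP[_ /cvgrPdist_lt/(_ (e `^ q) (powR_gt0 _ e0))].
apply: filterS => k; rewrite /= /F Lnormr_powR//= sub0r normrN.
rewrite ger0_norm ?powR_ge0// => h; rewrite ltNge; apply/negP => eN.
move: h; rewrite ltNge => /negP; apply.
by apply: ge0_ler_powR; rewrite ?nnegrE ?Lnormr_ge0// ltW.
Qed.

(** Taking the value 1 at the zeros of [f] keeps |s| = 1 everywhere, so that multiplication by [s]
    preserves absolute values. *)
Lemma sign_selector f : measurable_fun setT f ->
  exists s : T -> R, [/\ measurable_fun setT s, forall x, `|s x| = 1 &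
    forall x, f x * s x = `|f x|].
Proof.
move=> mf; exists (fun x => if 0 <= f x then 1 else -1); split.
- apply: measurable_fun_ifT => //; apply: measurable_fun_ler => //.
- by move=> x; case: ifP; rewrite ?normrN normr1.
- move=> x; case: ifPn => [f0|]; first by rewrite mulr1 ger0_norm.
  by rewrite -ltNge => f0; rewrite mulrN1 ltr0_norm.
Qed.

Definition bounded_mfun (g : T -> R) : Prop :=
  measurable_fun setT g /\ exists K : R, forall x, `|g x| <= K.

Lemma bounded_mfun_indic A : measurable A -> bounded_mfun (\1_A : T -> R).
Proof.
move=> mA; split; first exact: measurable_indic.
by exists 1 => x; rewrite indicE; case: (_ \in _); rewrite ?normr0 ?normr1.
Qed.

(* Subtracting the indicator of [g >= 1/2] halves the range [0, 1] of g without
   changing the value of the functional, so that value is at most C / 2 ^ k for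
   all k. *)
Lemma bounded_functional_eq0 (Delta : (T -> R) -> R) (C : R) :
  (forall a f g, bounded_mfun f -> bounded_mfun g ->
    Delta (fun x => a * f x + g x) = a * Delta f + Delta g) ->
  (forall g, measurable_fun setT g -> (forall x, 0 <= g x <= 1) ->
    `|Delta g| <= C) ->
  (forall A, measurable A -> Delta (\1_A) = 0) ->
  forall g, bounded_mfun g -> Delta g = 0.
Proof.
move=> lin leC ind.
have halve k g : measurable_fun setT g -> (forall x, 0 <= g x <= 1) ->
    `|Delta g| * 2 ^+ k <= C.
  elim: k g => [|k ih] g mg g01; first by rewrite expr0 mulr1; exact: leC.
  pose A := [set x | 2^-1 <= g x].
  have mA : measurable A by rewrite -(setTI A); exact: measurable_fun_le.
  pose h x := - 2^-1 * \1_A x + g x.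
  have mh : measurable_fun setT h.
    by apply: measurable_funD => //; apply: measurable_funM.
  have h01 x : 0 <= h x <= 2^-1.
    rewrite /h indicE; have := g01 x; have [/set_mem|/negP] := boolP (x \in A).
      by rewrite /A /=; lra.
    by rewrite inE /A /= => /negP; rewrite -ltNge; lra.
  have bg : bounded_mfun g.
    by split => //; exists 1 => x; have := g01 x; rewrite ler_norml; lra.
  have bh : bounded_mfun h.
    by split => //; exists 1 => x; have := h01 x; rewrite ler_norml; lra.
  have -> : Delta g = Delta h.
    by rewrite lin ?ind ?mulr0 ?add0r//; exact: bounded_mfun_indic.
  have E : Delta (fun x => 1 * h x + h x) = Delta h *+ 2.
    by rewrite (lin 1 h h)// mul1r mulr2n.
  have -> : `|Delta h| * 2 ^+ k.+1 = `|Delta (fun x => 1 * h x + h x)| * 2 ^+ k.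
    by rewrite E normrMn exprS; ring.
  apply: ih; first by apply: measurable_funD => //; apply: measurable_funM.
  by move=> x; have := h01 x; lra.
have g01_0 g : measurable_fun setT g -> (forall x, 0 <= g x <= 1) -> Delta g = 0.
  move=> mg g01; apply/eqP; rewrite -normr_eq0 eq_le normr_ge0 andbT leNgt.
  apply/negP => d0.
  have := halve (Num.truncn (C / `|Delta g|)).+1 g mg g01.
  apply/negP; rewrite -ltNge mulrC -ltr_pdivrMr//.
  apply: lt_trans (truncnS_gt _) _.
  by rewrite -natrX ltr_nat ltn_expl.
move=> g [mg [K gK]].
have [K' K0 gK'] : exists2 K' : R, 0 < K' & forall x, - K' <= g x <= K'.
  exists (`|K| + 1) => [|x]; first by rewrite ltr_wpDl.
  by rewrite -ler_norml; apply: le_trans (gK x) _; rewrite ler_wpDr ?ler_norm.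
have bg : bounded_mfun g by split => //; exists K.
have bT : bounded_mfun (\1_setT) := bounded_mfun_indic measurableT.
have b0 : bounded_mfun (\1_set0) := bounded_mfun_indic measurable0.
have <- : Delta (fun x => K' * \1_setT x + g x) = Delta g.
  by rewrite lin// ind ?mulr0 ?add0r.
(* An affine change brings the range [-K', K'] into [0, 1]; [Delta] does not see the added constant,
   since it vanishes on the indicator of the whole space. *)
pose g1 x := (K' + g x) / (2 * K').
have mg1 : measurable_fun setT g1.
  by apply: measurable_funM => //; apply: measurable_funD.
have g101 x : 0 <= g1 x <= 1.
  have /andP[? ?] := gK' x; apply/andP; split.
    by apply: divr_ge0; lra.
  by rewrite ler_pdivrMr ?mulr_gt0//; lra.
have bg1 : bounded_mfun g1.
  by split => //; exists 1 => x; have := g101 x; rewrite ler_norml; lra.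
rewrite (_ : (fun x => _) = fun x => (2 * K') * g1 x + \1_set0 x).
  by rewrite lin// ind// g01_0// mulr0 addr0.
apply/funext => x; rewrite !indicE in_setT in_set0 /g1 addr0 mulr1.
by field; rewrite gt_eqF.
Qed.

Lemma Lnormr_indic (q : R) A : 1 <= q -> measurable A -> (mu A < +oo)%E ->
  (\1_A : T -> R) \in Lfun mu q%:E /\ (Lnormr q%:E (\1_A) `^ q)%:E = mu A.
Proof.
move=> q1 mA muA; have q0 : q != 0 by rewrite gt_eqF// (lt_le_trans ltr01).
have E : (\int[mu]_x (`|\1_A x| `^ q)%:E = mu A)%E.
  under eq_integral => x _.
    rewrite (_ : _ `^ q = \1_A x); last first.
      by rewrite indicE; case: (_ \in _); rewrite ?normr1 ?powR1 ?normr0 ?powR0.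
    over.
  by rewrite integral_indic// setIT.
have AL : (\1_A : T -> R) \in Lfun mu q%:E.
  by apply/LfunP_powR => //; split; [exact: measurable_indic|rewrite E].
by split => //; rewrite -Lnormr_powR.
Qed.

End Lfun_lemmas.

Lemma patch_lin (T : Type) (R : realType) (D : set T) (a : R) (f g : T -> R) :
  (fun x => a * f x + g x) \_ D = fun x => a * (f \_ D) x + (g \_ D) x.
Proof.
by apply/funext => x; rewrite /patch; case: ifP; rewrite ?mulr0 ?addr0.
Qed.

Lemma indic_patch (T : Type) (R : realType) (D A : set T) :
  (\1_A : T -> R) \_ D = \1_(A `&` D).
Proof.
apply/funext => x; rewrite /patch !indicE in_setI.
by case: (x \in D); rewrite ?andbT ?andbF.
Qed.

(** * Riesz representation of functionals on L^q over a set of finite measure *)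

Section riesz.
Context d (T : measurableType d) (R : realType).
Context (mu : {sigma_finite_measure set T -> \bar R}).
Context (D : set T) (p : \bar R) (q M : R) (ell : (T -> R) -> R).
Context (mD : measurable D) (muD : (mu D < +oo)%E).
Context (p1 : (1 < p)%E) (q1 : 1 <= q) (pq : (p^-1 + (q%:E)^-1 = 1)%E).
Context (M0 : 0 <= M).
Context (ell_lin : forall a f g, f \in Lfun mu q%:E -> g \in Lfun mu q%:E ->
  ell (fun x => a * f x + g x) = a * ell f + ell g).
Context (ell_le : forall f, f \in Lfun mu q%:E ->
  `|ell f| <= M * Lnormr mu q%:E f).

(** Cutting off outside [D], a set of finite measure, brings all bounded measurable functions into
    the domain of the functional. *)
Let L (g : T -> R) : R := ell (g \_ D).

Let Lfun1D : (\1_D : T -> R) \in Lfun mu q%:E.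
Proof. by have [] := Lnormr_indic q1 mD muD. Qed.

Let measurable_patch (g : T -> R) :
  measurable_fun setT g -> measurable_fun setT (g \_ D).
Proof. by move=> mg; apply/(measurable_restrictT _ mD)/measurable_funTS. Qed.

Let Lfun_patch (g : T -> R) : g \in Lfun mu q%:E -> g \_ D \in Lfun mu q%:E.
Proof.
move=> gq; apply: Lfun_le (gq) _ => //.
  by apply: measurable_patch; move/LfunPl: gq => [].
by move=> x; rewrite /patch; case: ifP; rewrite // normr0.
Qed.

Let bounded_patch (g : T -> R) : bounded_mfun g -> g \_ D \in Lfun mu q%:E.
Proof.
move=> [mg [K gK]]; apply: Lfun_le (Lfun_scaler K _ Lfun1D) _ => //.
  exact: measurable_patch.
move=> x; rewrite /patch indicE; case: ifP => _; last by rewrite normr0.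
by rewrite mulr1; apply: le_trans (gK x) (ler_norm _).
Qed.

Let L_lin a f g : bounded_mfun f -> bounded_mfun g ->
  L (fun x => a * f x + g x) = a * L f + L g.
Proof. by move=> bf bg; rewrite /L patch_lin ell_lin//; exact: bounded_patch. Qed.

Let L_set0 : L (\1_set0) = 0.
Proof.
have b0 := bounded_mfun_indic R (@measurable0 _ T).
have := L_lin 1 b0 b0; rewrite (_ : (fun x => _) = \1_set0); last first.
  by apply/funext => x; rewrite indicE in_set0 mulr0 addr0.
lra.
Qed.

Let L_setU A B : measurable A -> measurable B -> A `&` B = set0 ->
  L (\1_(A `|` B)) = L (\1_A) + L (\1_B).
Proof.
move=> mA mB AB; rewrite -[L (\1_A)]mul1r -L_lin; [|exact: bounded_mfun_indic..].
congr L; apply/funext => x; rewrite !indicE mul1r in_setU.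
have : x \in A `&` B = false by rewrite AB in_set0.
by rewrite in_setI; case: (x \in A); case: (x \in B) => //= _; rewrite ?addr0 ?add0r.
Qed.

Definition functional_charge (A : set T) : \bar R := (L (\1_A))%:E.
Local Notation nu := functional_charge.

Let nu0 : nu set0 = 0%E.
Proof. by rewrite /nu L_set0. Qed.

Let nu_fin A : measurable A -> nu A \is a fin_num.
Proof. by []. Qed.

(** Finite additivity reduces the claim to the tails [W k]: cut off to [D], their indicators tend to
    0 in L^q by dominated convergence, as q is finite, and [ell] is bounded by the L^q norm. *)
Let nu_sigma_additive : semi_sigma_additive nu.
Proof.
move=> F mF tF mUF.
pose U k := \big[setU/set0]_(i < k) F i.
have mU k : measurable (U k) by apply: bigsetU_measurable.
have sumU k : (\sum_(0 <= i < k) nu (F i))%E = (L (\1_(U k)))%:E.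
  elim: k => [|k ih]; first by rewrite big_nil /U big_ord0 L_set0.
  rewrite big_nat_recr//= ih /U big_ord_recr/= L_setU//; first exact: mU.
  apply/seteqP; split=> // x []; rewrite -bigcup_mkord => -[i /= ik Fix] Fkx.
  have /seteqP[/(_ x) + _] := (trivIsetP.1 tF) i k I I (negbT (ltn_eqF ik)).
  by apply.
pose W k : set T := (\bigcup_i F i) `\` U k.
have mW k : measurable (W k) by exact: measurableD.
have LW k : L (\1_(\bigcup_i F i)) - L (\1_(U k)) = L (\1_(W k)).
  rewrite -[X in L (\1_X) - _](@setDUK _ (U k)).
    by rewrite (L_setU (mU k) (mW k)) ?setDIK// addrAC subrr add0r.
  by rewrite /U -bigcup_mkord => x [i _ Fix]; exists i.
rewrite (_ : (fun k => _) = EFin \o (fun k => L (\1_(U k)))); last first.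
  by apply/funext => k; rewrite sumU.
apply/fine_cvgP; split; first exact: nearW.
apply/cvgrPdist_lt => e e0 /=.
(* The bound [M] may be 0, hence the division by [M + 1]. *)
have e1 : 0 < e / (M + 1) by rewrite divr_gt0// ltr_wpDl.
have : \forall k \near \oo, Lnormr mu q%:E ((\1_(W k) : T -> R) \_ D) < e / (M + 1).
  apply: (Lnormr_dominated_cvg0 q1 Lfun1D) => //.
  - by move=> k; apply: measurable_patch; exact: measurable_indic.
  - move=> k x; rewrite indic_patch !indicE in_setI.
    case: (x \in D); rewrite ?andbT ?andbF// normr1.
    by case: (x \in W k); rewrite ?normr1 ?normr0.
  - move=> x; have [[i Fix]|nF] := pselect (exists i, F i x).
      exists i.+1 => // k /= ik; rewrite indic_patch indicE memNset// => -[[_ nU] _].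
      by apply: nU; rewrite /U -bigcup_mkord; exists i.
    apply: nearW => k; rewrite indic_patch indicE memNset// => -[[[i _ Fix] _] _].
    by apply: nF; exists i.
apply: filterS => k; rewrite ltr_pdivlMr ?ltr_wpDl// => h.
rewrite LW; apply: le_lt_trans (ell_le (bounded_patch (bounded_mfun_indic R (mW k)))) _.
apply: le_lt_trans h; rewrite mulrC; apply: ler_wpM2l; first exact: Lnormr_ge0.
by rewrite lerDl.
Qed.

HB.instance Definition _ := isCharge.Build _ _ _ nu nu0 nu_fin nu_sigma_additive.

Let nu_dominated : nu `<< mu.
Proof.
apply/null_content_dominatesP => A mA muA; congr EFin; apply/eqP.
rewrite -normr_eq0 eq_le normr_ge0 andbT.
apply: le_trans (ell_le (bounded_patch (bounded_mfun_indic R mA))) _.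
have mAD : measurable (A `&` D) by exact: measurableI.
have muAD : mu (A `&` D) = 0%E by apply: subset_measure0 muA.
have muADy : (mu (A `&` D) < +oo)%E by rewrite muAD.
have [_] := Lnormr_indic q1 mAD muADy.
rewrite [RHS]muAD => -[/powR_eq0_eq0]; rewrite indic_patch => ->.
by rewrite mulr0.
Qed.

Let density : exists h : T -> R, [/\ mu.-integrable setT (EFin \o h),
  forall x, ~ D x -> h x = 0 &
  forall A, measurable A -> L (\1_A) = \int[mu]_x (h x * \1_A x)].
Proof.
pose f := Radon_Nikodym nu mu.
have fin x : f x \is a fin_num by exact: Radon_Nikodym_fin_num nu_dominated.
exists ((fine \o f) \_ D); split.
- have := Radon_Nikodym_integrable nu_dominated.
  move=> /(integrableS measurableT mD (@subsetT _ D)) /(integrable_mkcond _ mD).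
  apply: eq_integrable => // x _.
  by rewrite /patch /=; case: ifP => // _; rewrite fineK.
- by move=> x Dx; rewrite /patch memNset.
- move=> A mA.
  have mAD : measurable (A `&` D) by exact: measurableI.
  have -> : L (\1_A) = fine (nu (A `&` D)).
    by rewrite /nu /L /= !indic_patch -setIA setIid.
  rewrite (Radon_Nikodym_integral nu_dominated mAD) integral_mkcond /Rintegral.
  congr fine; apply: eq_integral => x _.
  rewrite /patch indicE in_setI; case: (x \in D); rewrite ?andbF ?mul0r ?andbT//.
  by case: (x \in A); rewrite ?mulr1 ?mulr0//= fineK.
Qed.

(** Testing on the sign of [h] times the indicator of A = {|h| > M + e} gives (M + e) mu(A) <= M
    mu(A). As [A] is contained in [D], its measure is finite, hence 0. *)
Let density_ess_bounded (h : T -> R) : q = 1 -> measurable_fun setT h ->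
  (forall g, bounded_mfun g -> mu.-integrable setT (fun x => (h x * g x)%:E)) ->
  (forall g, bounded_mfun g -> L g = \int[mu]_x (h x * g x)) ->
  (forall x, ~ D x -> h x = 0) ->
  forall e : R, 0 < e -> \forall x \ae mu, `|h x| <= M + e.
Proof.
move=> q1' mh ihg LE hD e e0.
have [s [ms s1 hs]] := sign_selector mh.
have mhn : measurable_fun setT (fun x => `|h x|) by exact: measurableT_comp.
pose A := [set x | M + e < `|h x|].
have mA : measurable A.
  rewrite (_ : A = ~` (setT `&` [set x | `|h x| <= M + e])).
    by apply: measurableC; exact: measurable_fun_le.
  by rewrite setTI; apply/seteqP; split=> x; rewrite /A /= ltNge => /negP.
have AD : A `<=` D.
  move=> x; rewrite /A /= => Mh; apply: contrapT => /hD h0.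
  by move: Mh; rewrite h0 normr0 ltNge addr_ge0 // ltW.
have muA : (mu A < +oo)%E.
  by apply: le_lt_trans muD; apply: le_measure; rewrite ?inE.
have [Aq AN] := Lnormr_indic q1 mA muA.
pose g x := s x * \1_A x.
have bg : bounded_mfun g.
  split; first by apply: measurable_funM => //; exact: measurable_indic.
  exists 1 => x; rewrite /g normrM s1 mul1r indicE.
  by case: (_ \in _); rewrite ?normr0 ?normr1.
have ig := ihg g bg.
have i1A : mu.-integrable setT (EFin \o \1_A).
  by move: Aq; rewrite q1' => /Lfun1_integrable.
have le1 : (M + e) * Lnormr mu q%:E (\1_A) <= \int[mu]_x (h x * g x).
  have -> : (M + e) * Lnormr mu q%:E (\1_A) = \int[mu]_x ((M + e) * \1_A x).
    rewrite RintegralZl//.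
    congr (_ * _); rewrite /Rintegral integral_indic// setIT -AN q1' powRr1//.
    exact: Lnormr_ge0.
  apply: le_Rintegral => //.
    exact: integrableZl i1A.
  move=> x _; rewrite /g mulrA hs indicE; case: (boolP (x \in A)) => [/set_mem|_].
    by rewrite !mulr1 => /ltW.
  by rewrite !mulr0.
have le2 : \int[mu]_x (h x * g x) <= M * Lnormr mu q%:E (\1_A).
  rewrite -LE//; apply: le_trans (ler_norm _) _.
  apply: le_trans (ell_le (bounded_patch bg)) _; apply: ler_wpM2l => //.
  apply: le_Lnormr => //; first by apply: measurable_patch; exact: bg.1.
  move=> x; rewrite /patch /g; case: ifP; rewrite ?normr0//.
  by rewrite normrM s1 mul1r.
have N0 : Lnormr mu q%:E (\1_A) = 0.
  apply/eqP; rewrite eq_le Lnormr_ge0 andbT.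
  by have := le_trans le1 le2; rewrite mulrDl; nra.
have muA0 : mu A = 0%E by rewrite -AN N0 powR0// q1' oner_neq0.
exists A; split => // x /= /negP; rewrite -ltNge; exact.
Qed.

(** The test function is sgn(h) |h|^(r-1), cut off to {|h| <= k} so as to be bounded. It satisfies
    |g|^q = h g because (r - 1) q = r. If N is its L^q norm, then N^q <= M N, so N^(q-1) <= M and
    N^q = (N^(q-1))^r <= M^r. The bound is uniform in [k], and monotone convergence concludes. *)
Let density_powR_bounded (h : T -> R) (r : R) :
  p = r%:E -> 1 < r -> 1 < q -> r^-1 + q^-1 = 1 ->
  measurable_fun setT h ->
  (forall g, bounded_mfun g -> L g = \int[mu]_x (h x * g x)) ->
  (forall x, ~ D x -> h x = 0) ->
  (\int[mu]_x (`|h x| `^ r)%:E <= (M `^ r)%:E)%E.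
Proof.
move=> pr r1 q1' rq mh LE hD.
have r0 : 0 < r := lt_trans ltr01 r1.
have q0 : 0 < q := lt_trans ltr01 q1'.
have rqE : r * q = r + q.
  rewrite -[LHS]mul1r -rq; field; by rewrite !gt_eqF.
have [s [ms s1 hs]] := sign_selector mh.
have mhn : measurable_fun setT (fun x => `|h x|) by exact: measurableT_comp.
have mhr t : measurable_fun setT (fun x => `|h x| `^ t).
  exact: (measurableT_comp (measurable_powR _)).
pose A k := [set x | `|h x| <= k%:R].
have mA k : measurable (A k) by rewrite -(setTI (A k)); exact: measurable_fun_le.
pose F k x := `|h x| `^ r * \1_(A k) x.
have mF k : measurable_fun setT (F k).
  by apply: measurable_funM => //; exact: measurable_indic.
have F0 k x : 0 <= F k x by rewrite /F mulr_ge0 ?powR_ge0.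
have FM k : (\int[mu]_x (F k x)%:E <= (M `^ r)%:E)%E.
  pose g x := s x * (`|h x| `^ (r - 1) * \1_(A k) x).
  have mg : measurable_fun setT g.
    by do 2 apply: measurable_funM => //; exact: measurable_indic.
  have gE x : `|g x| = `|h x| `^ (r - 1) * \1_(A k) x.
    by rewrite /g normrM s1 mul1r ger0_norm// mulr_ge0 ?powR_ge0.
  have bg : bounded_mfun g.
    split => //; exists (k%:R `^ (r - 1)) => x; rewrite gE indicE.
    case: (boolP (x \in A k)) => [/set_mem Ax|_]; last by rewrite mulr0 powR_ge0.
    rewrite mulr1; apply: ge0_ler_powR; rewrite ?nnegrE ?ler0n//.
    by rewrite subr_ge0 ltW.
  have gD : g \_ D = g.
    apply/funext => x; rewrite /patch; case: ifPn => //; rewrite notin_setE => /hD hx.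
    by rewrite /g hx normr0 powR0 ?mul0r ?mulr0// subr_eq0 gt_eqF.
  have gq : g \in Lfun mu q%:E by rewrite -gD; exact: bounded_patch.
  have gqE x : `|g x| `^ q = F k x.
    rewrite gE /F indicE; case: (x \in A k); rewrite ?mulr0 ?mulr1; last first.
      by rewrite powR0// gt_eqF.
    by rewrite -powRrM; congr (_ `^ _); rewrite mulrBl rqE mul1r addrK.
  have hgE x : h x * g x = F k x.
    by rewrite /g /F mulrA hs mulrA mulr_powRB1.
  pose N := Lnormr mu q%:E g.
  have N0 : 0 <= N by exact: Lnormr_ge0.
  have FN : (\int[mu]_x (F k x)%:E = (N `^ q)%:E)%E.
    by rewrite -Lnormr_powR//; apply: eq_integral => x _; rewrite gqE.
  have NM : N `^ q <= M * N.
    have <- : L g = N `^ q.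
      by rewrite LE//; under eq_Rintegral do rewrite hgE; rewrite /Rintegral FN.
    by apply: le_trans (ler_norm _) _; rewrite /L gD; exact: ell_le.
  rewrite FN lee_fin; have [N00|N00] := eqVneq N 0.
    by rewrite N00 powR0 ?powR_ge0// gt_eqF.
  have Npos : 0 < N by rewrite lt_neqAle eq_sym N00.
  have NqM : N `^ (q - 1) <= M.
    by rewrite -(ler_pM2l Npos) mulr_powRB1// [leRHS]mulrC.
  have -> : N `^ q = (N `^ (q - 1)) `^ r.
    by rewrite -powRrM; congr (_ `^ _); lra.
  by apply: ge0_ler_powR; rewrite ?nnegrE ?powR_ge0 ?(ltW r0).
have Flim x : limn (fun k => (F k x)%:E) = (`|h x| `^ r)%:E.
  apply: cvg_lim => //; apply: cvg_near_cst.
  exists (Num.truncn `|h x|).+1 => // k /= hk; rewrite /F indicE mem_set ?mulr1//.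
  by rewrite /A /=; apply: ltW; apply: lt_le_trans (truncnS_gt _) _; rewrite ler_nat.
have Fnd x : {homo (fun k => (F k x)%:E) : m k / (m <= k)%N >-> (m <= k)%E}.
  move=> m k mk; rewrite lee_fin /F ler_wpM2l ?powR_ge0// !indicE.
  case: (boolP (x \in A m)) => [/set_mem Am|_]; last by rewrite ler0n.
  by rewrite mem_set// /A /=; apply: le_trans Am _; rewrite ler_nat.
under eq_integral do rewrite -Flim.
rewrite monotone_convergence//; last 2 first.
- by move=> k; exact/measurable_EFinP.
- by move=> k x _; rewrite lee_fin.
apply: lime_le; last exact: nearW.
apply: ereal_nondecreasing_is_cvgn => m k mk; apply: ge0_le_integral => //.
- by move=> x _; rewrite lee_fin.
- exact/measurable_EFinP.
- exact/measurable_EFinP.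
- by move=> x _; exact: Fnd.
Qed.

Let density_Lfun (h : T -> R) : measurable_fun setT h ->
  (forall g, bounded_mfun g -> mu.-integrable setT (fun x => (h x * g x)%:E)) ->
  (forall g, bounded_mfun g -> L g = \int[mu]_x (h x * g x)) ->
  (forall x, ~ D x -> h x = 0) ->
  h \in Lfun mu p /\ Lnormr mu p h <= M.
Proof.
move=> mh ihg LE hD.
have [[poo q1']|[r [pr r1 q1' rq]]] := conjugate_exponentsP p1 q1 pq.
  have NM : ('N[mu]_p[EFin \o h] <= M%:E)%E.
    rewrite poo unlock; case: ifPn => _; last by rewrite lee_fin.
    apply/lee_addgt0Pr => e e0; apply/ess_supP.
    apply: filterS (density_ess_bounded q1' mh ihg LE hD e0) => x /=.
    by rewrite lee_fin.
  have hp : h \in Lfun mu p.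
    by apply/LfunPl; split => //; apply: le_lt_trans NM (ltry _).
  by split => //; rewrite -lee_fin -LnormrE.
have hr := density_powR_bounded pr r1 q1' rq mh LE hD.
have hp : h \in Lfun mu r%:E.
  by apply/LfunP_powR; [exact: ltW|split => //; exact: le_lt_trans hr (ltry _)].
rewrite pr; split => //; move: hr; rewrite Lnormr_powR ?(ltW r1)// lee_fin => NM.
rewrite leNgt; apply/negP => MN; move: NM; apply/negP; rewrite -ltNge.
by apply: gt0_ltr_powR; rewrite ?nnegrE ?Lnormr_ge0// (lt_trans ltr01).
Qed.

(** The formula is known on indicators and must reach bounded functions before L^q: the bounded case
    provides the test functions that put [h] in L^p, and only then does Hoelder's inequality make
    the right-hand side continuous on L^q. *)
Lemma riesz_representation : exists h : T -> R, [/\ h \in Lfun mu p,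
  Lnormr mu p h <= M, forall x, ~ D x -> h x = 0 &
  forall g, g \in Lfun mu q%:E -> L g = \int[mu]_x (h x * g x)].
Proof.
have [h [ih hD Lind]] := density.
have mh : measurable_fun setT h by move/measurable_int : ih => /measurable_EFinP.
have ihg g : bounded_mfun g -> mu.-integrable setT (fun x => (h x * g x)%:E).
  move=> [mg [K gK]]; have iK := integrableZl measurableT K ih.
  apply: (le_integrable measurableT _ _ iK).
    by apply/measurable_EFinP; exact: measurable_funM.
  move=> x _; rewrite /= lee_fin !normrM mulrC ler_wpM2r//.
  by apply: le_trans (gK x) (ler_norm _).
have LE g : bounded_mfun g -> L g = \int[mu]_x (h x * g x).
  move=> bg; apply/eqP; rewrite -subr_eq0; apply/eqP; move: g bg.
  (* The difference of the two sides vanishes on indicators. For [g] with values in [0, 1] its two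
     terms are at most [M] times the norm of the indicator of [D] and the integral of |h|. *)
  apply: (@bounded_functional_eq0 _ _ _ (fun g => L g - \int[mu]_x (h x * g x))
    (M * Lnormr mu q%:E (\1_D) + \int[mu]_x `|h x|)) => [a f g bf bg|g mg g01|A mA].
  - rewrite L_lin//; under eq_Rintegral do rewrite mulrDr mulrCA.
    rewrite RintegralD//; [|exact: integrableZl (ihg f bf)|exact: ihg].
    by rewrite RintegralZl; [ring|exact: measurableT|exact: ihg].
  - have bg : bounded_mfun g.
      by split => //; exists 1 => x; have := g01 x; rewrite ler_norml; lra.
    apply: le_trans (ler_normB _ _) _; apply: lerD.
      apply: le_trans (ell_le (bounded_patch bg)) _; apply: ler_wpM2l => //.
      apply: le_Lnormr => //; first exact: measurable_patch.
      move=> x; rewrite /patch indicE; case: ifP; rewrite ?normr0 ?normr1// => _.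
      by have := g01 x; rewrite ler_norml; lra.
    apply: le_trans (le_normr_Rintegral measurableT (ihg g bg)) _.
    apply: le_Rintegral => //.
    - exact: integrable_norm (ihg g bg).
    - exact: integrable_norm.
    move=> x _; rewrite normrM ler_piMr//; have := g01 x; rewrite ler_norml; lra.
  - by rewrite Lind// subrr.
have hp : h \in Lfun mu p /\ Lnormr mu p h <= M.
  exact: density_Lfun.
exists h; split; [exact: hp.1|exact: hp.2|exact: hD|] => g gq.
have mg : measurable_fun setT g by move/LfunPl: gq => [].
(* Truncation in value: the formula holds for [g_ k], and both sides are small on the remainder
   [r_ k], whose L^q norm tends to 0. *)
pose g_ k x := g x * \1_[set y | `|g y| <= k%:R] x.
have mA k : measurable [set y | `|g y| <= k%:R].
  rewrite -(setTI [set y | _]); apply: measurable_fun_le => //.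
  exact: measurableT_comp.
have bg k : bounded_mfun (g_ k).
  split; first by apply: measurable_funM => //; exact: measurable_indic.
  exists k%:R => x; rewrite /g_ indicE; case: (boolP (x \in _)) => [/set_mem|_].
    by rewrite mulr1.
  by rewrite mulr0 normr0.
have gkq k : g_ k \in Lfun mu q%:E.
  apply: Lfun_le gq _ => //; first exact: (bg k).1.
  by move=> x; rewrite /g_ indicE; case: (x \in _); rewrite ?mulr1 ?mulr0 ?normr0.
pose r_ k x := - 1 * g_ k x + g x.
have rq k : r_ k \in Lfun mu q%:E by exact: Lfun_lin.
have small e : 0 < e -> \forall k \near \oo, Lnormr mu q%:E (r_ k) < e.
  move=> e0; apply: (Lnormr_dominated_cvg0 q1 gq) e0 => [k|k x|x].
  - by move/LfunPl: (rq k) => [].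
  - rewrite /r_ /g_ indicE; case: (x \in _).
      by rewrite mulr1 mulN1r addNr normr0.
    by rewrite !mulr0 add0r.
  - exists (Num.truncn `|g x|).+1 => // k /= gk.
    rewrite /r_ /g_ indicE mem_set ?mulr1 ?mulN1r ?addNr//=.
    by apply: ltW; apply: lt_le_trans (truncnS_gt _) _; rewrite ler_nat.
apply/eqP; rewrite -subr_eq0 -normr_eq0 eq_le normr_ge0 andbT.
apply/ler_addgt0Pr => e e0; rewrite add0r.
have e1 : 0 < e / (M + Lnormr mu p h + 1).
  by rewrite divr_gt0// ltr_wpDl// addr_ge0// Lnormr_ge0.
have [k _ /(_ k (leqnn k))/=] := small _ e1.
rewrite ltr_pdivlMr ?ltr_wpDl ?addr_ge0 ?Lnormr_ge0// => rk.
have Lr : L g = L (g_ k) + L (r_ k).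
  rewrite -[L (g_ k)]mul1r /L -ell_lin; [|exact: Lfun_patch..].
  by rewrite -patch_lin; congr ell; congr patch; apply/funext => x; rewrite /r_; ring.
have Jr : \int[mu]_x (h x * g x) =
    \int[mu]_x (h x * g_ k x) + \int[mu]_x (h x * r_ k x).
  rewrite -RintegralD//; [|exact: (integrable_hoelder p1 q1 pq hp.1)..].
  by apply: eq_Rintegral => x _; rewrite /r_; ring.
rewrite Lr Jr LE// opprD addrACA subrr add0r.
apply: le_trans (ler_normB _ _) _; apply: le_trans (ltW rk).
rewrite mulrDr mulr1 mulrDr ler_wpDr ?Lnormr_ge0//; apply: lerD.
  apply: le_trans (ell_le (Lfun_patch (rq k))) _; rewrite mulrC ler_wpM2r//.
  apply: le_Lnormr => //; first by apply: measurable_patch; move/LfunPl: (rq k) => [].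
  by move=> x; rewrite /patch; case: ifP; rewrite // normr0.
by rewrite mulrC; exact: Rintegral_hoelder p1 q1 pq hp.1 (rq k).
Qed.

End riesz.

Section dual_function.
Context d (T : measurableType d) (R : realType) (mu : {measure set T -> \bar R}).
Context (p : \bar R) (q : R).
Context (p1 : (1 < p)%E) (q1 : 1 <= q) (pq : (p^-1 + (q%:E)^-1 = 1)%E).

Lemma Lnorm_pinfty_le (f : T -> R) (M : R) : 0 <= M -> (forall x, `|f x| <= M) ->
  ('N[mu]_+oo[EFin \o f] <= M%:E)%E.
Proof.
move=> M0 fM; rewrite unlock; case: ifPn => _; last by rewrite lee_fin.
by apply/ess_supP/nearW => x; rewrite lee_fin.
Qed.

Lemma Lfun_indic A : measurable A -> (mu A < +oo)%E ->
  (\1_A : T -> R) \in Lfun mu p.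
Proof.
move=> mA muA; have [[-> _]|[r [-> r1 _ _]]] := conjugate_exponentsP p1 q1 pq.
  apply/LfunPl; split; first exact: measurable_indic.
  apply: (@le_lt_trans _ _ 1%:E); last exact: ltry.
  apply: Lnorm_pinfty_le => // x.
  by rewrite indicE; case: (_ \in _); rewrite ?normr1 ?normr0.
by have [] := Lnormr_indic (ltW r1) mA muA.
Qed.

Lemma Lfun_abs s (f : T -> R) : (1 <= s)%E -> f \in Lfun mu s ->
  (fun x => `|f x|) \in Lfun mu s.
Proof.
move=> s1 fs; apply: Lfun_le (fs) _ => //.
  by apply: measurableT_comp => //; move/LfunPl: fs => [].
by move=> x; rewrite normr_id.
Qed.

Lemma Lnormr_abs s (f : T -> R) :
  Lnormr mu s (fun x => `|f x|) = Lnormr mu s f.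
Proof. by rewrite [RHS]/Lnormr -Lnorm_abse. Qed.

(* The case of equality in Hoelder's inequality. *)
Lemma dual_function (h : T -> R) : h \in Lfun mu q%:E -> exists k : T -> R,
  [/\ k \in Lfun mu p, forall x, h x * k x = `|h x| `^ q &
      Lnormr mu p k <= Lnormr mu q%:E h `^ (q - 1)].
Proof.
move=> hq; have /LfunPl[mh _] := hq.
have q0 : 0 < q := lt_le_trans ltr01 q1.
have [s [ms s1 hs]] := sign_selector mh.
have [[poo q1']|[r [pr r1 q1' rq]]] := conjugate_exponentsP p1 q1 pq.
  have sN : ('N[mu]_p[EFin \o s] <= 1%:E)%E.
    by rewrite poo; apply: Lnorm_pinfty_le => // x; rewrite s1.
  have sp : s \in Lfun mu p.
    by apply/LfunPl; split => //; exact: le_lt_trans sN (ltry _).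
  exists s; split => // [x|]; first by rewrite q1' powRr1.
  (* For q = 1 the bound is a power with exponent 0, equal to 1 even when the norm of [h] is 0. *)
  by rewrite q1' subrr powRr0 -lee_fin -LnormrE.
have r0 : 0 < r := lt_trans ltr01 r1.
have rqE : r * q = r + q by rewrite -[LHS]mul1r -rq; field; rewrite !gt_eqF.
pose k x := s x * `|h x| `^ (q - 1).
have mk : measurable_fun setT k.
  apply: measurable_funM => //; apply: (measurableT_comp (measurable_powR _)).
  exact: measurableT_comp.
have kE x : `|k x| `^ r = `|h x| `^ q.
  rewrite /k normrM s1 mul1r ger0_norm ?powR_ge0// -powRrM; congr (_ `^ _); lra.
have kq : (\int[mu]_x (`|k x| `^ r)%:E = (Lnormr mu q%:E h `^ q)%:E)%E.
  by rewrite -(Lnormr_powR q1 hq); apply: eq_integral => x _; rewrite kE.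
have kr : k \in Lfun mu r%:E.
  by apply/LfunP_powR; [exact: ltW|split => //; rewrite kq ltry].
exists k; split => [|x|]; first by rewrite pr.
  by rewrite /k mulrA hs mulr_powRB1.
rewrite pr leNgt; apply/negP => lt.
have : Lnormr mu q%:E h `^ q < Lnormr mu r%:E k `^ r.
  rewrite (_ : _ `^ q = (Lnormr mu q%:E h `^ (q - 1)) `^ r); last first.
    by rewrite -powRrM; congr (_ `^ _); lra.
  by apply: gt0_ltr_powR; rewrite ?nnegrE ?powR_ge0 ?Lnormr_ge0.
by rewrite -lte_fin -(Lnormr_powR (ltW r1) kr) kq ltxx.
Qed.

End dual_function.

(** * The equivalence *)

Lemma Rintegral_sum d (T : measurableType d) (R : realType)
    (mu : {measure set T -> \bar R}) (D : set T) (I : Type) (s : seq I)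
    (F : I -> T -> R) : measurable D ->
  (forall i, mu.-integrable D (EFin \o F i)) ->
  mu.-integrable D (EFin \o (fun x => \sum_(i <- s) F i x)) /\
  \int[mu]_(x in D) \sum_(i <- s) F i x = \sum_(i <- s) \int[mu]_(x in D) F i x.
Proof.
move=> mD iF; elim: s => [|i s [ih1 ih2]].
  rewrite big_nil (_ : (fun x => _) = (fun=> 0)); last first.
    by apply/funext => x; rewrite big_nil.
  by split; [exact: integrable0|rewrite /Rintegral integral0].
rewrite big_cons (_ : (fun x => _) = (fun x => F i x + \sum_(j <- s) F j x)).
  split; last by rewrite RintegralD// ih2.
  by have := integrableD mD (iF i) ih1.
by apply/funext => x; rewrite big_cons.
Qed.

HB.instance Definition _ (R : realType) (n : nat) :=
  Measure_isSigmaFinite.Build _ (Rn R n) R (@lebesgue R n)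
    (@lebesgue_sigma_finite R n).

(** * The Poincare inequality and the divergence problem *)

Section poincare_divergence.
Context (R : realType) (n : nat) (Omega : set 'rV[R]_n) (x0 : 'rV[R]_n).
Context (Cn : R) (gamma : R -> 'rV[R]_n -> 'rV[R]_n).
Context (oOmega : open Omega) (bOmega : bounded_set Omega).
Context (fam : path_family Cn Omega x0 gamma).
Context (p : \bar R) (q : R).
Context (p1 : (1 < p)%E) (q1 : 1 <= q) (pq : (p^-1 + (q%:E)^-1 = 1)%E).

Local Notation mu := (@lebesgue R n).
Local Notation T := (Rn R n).
Local Notation w := (weight Omega gamma).
Local Notation D := (Omega : set T).

Let q1E : (1 <= q%:E)%E. Proof. by rewrite lee_fin. Qed.
Let p1E : (1 <= p)%E. Proof. exact: ltW. Qed.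

Let mD : measurable D. Proof. exact: measurable_rV_open. Qed.
Let muD : (mu D < +oo)%E. Proof. exact: lebesgue_outer_bounded. Qed.
Let mw : measurable_fun D (w : T -> R).
Proof. refine (measurable_weight oOmega bOmega fam). Qed.

Let patch_measurable (f : T -> R) : measurable_fun D f <->
  measurable_fun setT (f \_ D : T -> R).
Proof. exact: measurable_restrictT. Qed.

Lemma measurable_enorm (u : T -> 'rV[R]_n) (A : set T) :
  (forall i, measurable_fun A (fun x => u x ord0 i)) ->
  measurable_fun A (fun x => enorm (u x)).
Proof.
move=> mu_; rewrite (_ : (fun x => _) = (fun x => edot (u x) (u x) `^ 2^-1)).
  apply: (measurableT_comp (measurable_powR _)).
  by apply: measurable_sum => i; exact: measurable_funM.
by apply/funext => x; rewrite powR12_sqrt// edot_ge0.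
Qed.

Lemma measurable_edot (u v : T -> 'rV[R]_n) (A : set T) :
  (forall i, measurable_fun A (fun x => u x ord0 i)) ->
  (forall i, measurable_fun A (fun x => v x ord0 i)) ->
  measurable_fun A (fun x => edot (u x) (v x)).
Proof. by move=> mu_ mv; apply: measurable_sum => i; exact: measurable_funM. Qed.

(** [Omega] has finite measure, so its indicator is in L^p and Hoelder's inequality applies against
    it. *)
Lemma LpOn_integrable (f : T -> R) : LpOn Omega q%:E f ->
  mu.-integrable D (EFin \o f).
Proof.
move=> fq; apply/(integrable_mkcond _ mD).
have := integrable_hoelder p1 q1 pq (Lfun_indic p1 q1 pq mD muD) fq.
apply: eq_integrable => // x _ /=.
by rewrite /patch indicE; case: (x \in D); rewrite ?mul1r ?mul0r.
Qed.

Lemma integrable_patch (f : T -> R) :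
  mu.-integrable D (EFin \o f) <-> mu.-integrable setT (EFin \o (f \_ D)).
Proof.
rewrite (integrable_mkcond _ mD); split; apply: eq_integrable => // x _;
  by rewrite /patch /=; case: (x \in D).
Qed.

Lemma Eq_space_measurable g G i : Eq_space Omega gamma q g G ->
  measurable_fun D (fun x : T => G x ord0 i).
Proof. by move=> [_ /(_ i)[[]]]. Qed.

Let weighted_Lfun (G : 'rV[R]_n -> 'rV[R]_n) :
  (forall i, measurable_fun D (fun x : T => G x ord0 i)) ->
  (\int[mu]_(x in D) ((enorm (G x) `^ q) * (w x `^ q))%:E < +oo)%E <->
  ((fun x => w x * enorm (G x)) \_ D : T -> R) \in Lfun mu q%:E.
Proof.
move=> mG; rewrite LfunP_powR//.
have -> : (\int[mu]_(x in D) (enorm (G x) `^ q * w x `^ q)%:E =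
    \int[mu]_x (`|((fun x => w x * enorm (G x)) \_ D) x| `^ q)%:E)%E.
  rewrite integral_mkcond; apply: eq_integral => x _; rewrite /patch.
  case: (x \in D); last by rewrite normr0 powR0// gt_eqF// (lt_le_trans ltr01).
  rewrite ger0_norm; last exact: mulr_ge0 (weight_ge0 _ _ _) (enorm_ge0 _).
  by rewrite (powRM _ (weight_ge0 _ _ _) (enorm_ge0 _)) mulrC.
split=> [?|[]//]; split => //; apply/patch_measurable.
by apply: measurable_funM; [exact: mw|exact: measurable_enorm mG].
Qed.

Lemma measurable_unweighted (u : 'rV[R]_n -> 'rV[R]_n) :
  (forall i, measurable_fun D (fun x : T => u x ord0 i)) ->
  measurable_fun setT ((fun x => (w x)^-1 * enorm (u x)) \_ D : T -> R).
Proof.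
move=> mu_; apply/patch_measurable; apply: measurable_funM.
  rewrite (_ : (fun x => _) = (fun x : T => w x `^ (-1))).
    exact: (measurableT_comp (measurable_powR _)).
  by apply/funext => x; rewrite powR_inv1// weight_ge0.
exact: measurable_enorm mu_.
Qed.

Lemma Eq_space_Lfun_enorm g G : Eq_space Omega gamma q g G ->
  ((fun x => w x * enorm (G x)) \_ D : T -> R) \in Lfun mu q%:E.
Proof.
move=> gG; apply/weighted_Lfun; last by case: gG.
by move=> i; exact: Eq_space_measurable gG.
Qed.

Lemma Eq_space_Lfun_coord g G i : Eq_space Omega gamma q g G ->
  ((fun x => w x * G x ord0 i) \_ D : T -> R) \in Lfun mu q%:E.
Proof.
move=> gG; apply: Lfun_le (Eq_space_Lfun_enorm gG) _ => //.
  apply/patch_measurable; apply: measurable_funM; first exact: mw.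
  exact: Eq_space_measurable gG.
move=> x; rewrite /patch; case: (x \in D) => //.
rewrite normrM [leRHS]normrM ler_wpM2l// [leRHS]ger0_norm ?enorm_ge0//.
exact: ler_coord_enorm.
Qed.

(** Together with [Eq_space_Lfun_coord] this turns the integrability condition of E^q into one on
    components, which is visibly stable under linear combinations. *)
Lemma Lfun_coord_weighted (G : 'rV[R]_n -> 'rV[R]_n) :
  (forall i, measurable_fun D (fun x : T => G x ord0 i)) ->
  (forall i, ((fun x => w x * G x ord0 i) \_ D : T -> R) \in Lfun mu q%:E) ->
  (\int[mu]_(x in D) ((enorm (G x) `^ q) * (w x `^ q))%:E < +oo)%E.
Proof.
move=> mG GL; apply/weighted_Lfun => //.
have := @Lfun_sum _ _ _ mu q%:E _ (index_enum 'I_n) xpredT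
  (fun i x => `|((fun x => w x * G x ord0 i) \_ D) x|) q1E
  (fun i => Lfun_abs q1E (GL i)).
move=> SL; apply: Lfun_le SL _ => //.
  apply/patch_measurable; apply: measurable_funM; first exact: mw.
  exact: measurable_enorm mG.
move=> x; rewrite [leRHS]ger0_norm ?sumr_ge0// /patch; case: (x \in D).
  rewrite normrM ger0_norm ?weight_ge0// ger0_norm ?enorm_ge0//.
  apply: le_trans (ler_wpM2l (weight_ge0 _ _ _) (enorm_le_sum _)) _.
  by rewrite mulr_sumr ler_sum// => i _; rewrite normrM ger0_norm ?weight_ge0.
by rewrite normr0 sumr_ge0.
Qed.

(* Dealing with this impossible case saves the computation of the measure of a
   box. *)
Lemma weighted_poincare_null : (forall A : set 'rV[R]_n, lebesgue_outer A = 0%E) ->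
  weighted_poincare Omega gamma q.
Proof.
move=> mu0; exists 1 => // g G _.
have -> : (LnormOn Omega q%:E (fun x => g x - mean Omega g)%R = 0)%E.
  rewrite /LnormOn unlock (eq_measure_integral mzero); last first.
    by move=> A _ _; rewrite /mzero; exact: mu0.
  by rewrite integral_measure_zero poweR0r// invr_neq0// gt_eqF// (lt_le_trans ltr01).
by rewrite mul1e; exact: Lnorm_ge0.
Qed.

Let lebesgue_ge0_fin : (fine (mu D))%:E = mu D.
Proof. by rewrite fineK// ge0_fin_numE ?measure_ge0. Qed.

Lemma Rintegral_cstD (c : R) : \int[mu]_(x in D) c = c * fine (mu D).
Proof. by rewrite Rintegral_cst. Qed.

Lemma integrable_cstD (c : R) : mu.-integrable D (EFin \o cst c).
Proof.
apply/integrable_patch.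
have := integrableZl measurableT c (integrable_hoelder p1 q1 pq
  (Lfun_indic p1 q1 pq mD muD) (Lnormr_indic q1 mD muD).1).
apply: eq_integrable => // x _ /=; rewrite -EFinM; congr EFin.
by rewrite /patch indicE; case: (x \in D); rewrite ?mulr1 ?mulr0.
Qed.

Lemma Rintegral_sub_mean (g : T -> R) : mu D <> 0%E ->
  mu.-integrable D (EFin \o g) -> \int[mu]_(x in D) (g x - mean Omega g) = 0.
Proof.
move=> muD0 ig; rewrite RintegralB//; last exact: integrable_cstD.
rewrite Rintegral_cstD /mean mulrAC mulVf ?mul1r ?subrr//.
by apply/eqP => m0; apply: muD0; rewrite -lebesgue_ge0_fin m0.
Qed.

Lemma LpOn_sub_cst s (c : R) (g : T -> R) : (1 <= s)%E ->
  (\1_D : T -> R) \in Lfun mu s -> LpOn Omega s g ->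
  LpOn Omega s (fun x => g x - c).
Proof.
move=> s1 D1 gs; apply: eq_Lfun (Lfun_lin (- c) s1 D1 gs) => x.
by rewrite /patch indicE; case: (x \in D); rewrite ?mulr1 ?mulr0 ?addr0// addrC.
Qed.

Let Dq : (\1_D : T -> R) \in Lfun mu q%:E.
Proof. by have [] := Lnormr_indic q1 mD muD. Qed.

Let Dp : (\1_D : T -> R) \in Lfun mu p.
Proof. exact (Lfun_indic p1 q1 pq mD muD). Qed.

Lemma Rintegral_patchM (f g : T -> R) :
  \int[mu]_(x in D) (f x * g x) = \int[mu]_x ((f \_ D) x * (g \_ D) x).
Proof.
rewrite Rintegral_mkcond; apply: eq_Rintegral => x _.
by rewrite /patch; case: (x \in D); rewrite ?mul0r.
Qed.

Lemma LpOn_hoelder (f g : T -> R) : LpOn Omega p f -> LpOn Omega q%:E g ->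
  mu.-integrable D (fun x => (f x * g x)%:E) /\
  `|\int[mu]_(x in D) (f x * g x)| <=
    Lnormr mu p (f \_ D) * Lnormr mu q%:E (g \_ D).
Proof.
move=> fp gq; split; last by rewrite Rintegral_patchM; exact: Rintegral_hoelder.
apply/integrable_patch; have := integrable_hoelder p1 q1 pq fp gq.
apply: eq_integrable => // x _ /=.
by rewrite /patch; case: (x \in D); rewrite ?mul0r.
Qed.

Lemma LnormOnE s (f : T -> R) : LpOn Omega s f ->
  LnormOn Omega s f = (Lnormr mu s (f \_ D))%:E.
Proof. by move=> fs; rewrite -LnormrE. Qed.

Lemma divergence_solvable_poincare : (0 < n)%N -> Omega x0 ->
  divergence_solvable Omega gamma p q -> weighted_poincare Omega gamma q.
Proof.
move=> n0 Ox0 [C C0 divC].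
(* The existence of a non-null set makes the weight positive and the measure of [Omega] nonzero. *)
have [mu0|/existsNP muA] :=
  pselect (forall A : set 'rV[R]_n, lebesgue_outer A = 0%E).
  exact: weighted_poincare_null.
have w0 x : Omega x -> 0 < w x.
  by move=> Ox; exact: (weight_gt0 oOmega bOmega fam n0 Ox muA).
have muD0 : mu D <> 0%E.
  have [A nA] := muA; move=> D0; apply: nA.
  by apply: (open_null_lebesgue_outer_eq0 oOmega _ D0); exists x0.
pose m := fine (mu D); have m0 : m != 0.
  by apply/eqP => m0; apply: muD0; rewrite -lebesgue_ge0_fin -/m m0.
(* An upper bound for the factor by which subtracting the mean changes the L^p norm of [k]: by
   Hoelder the mean is at most |1/m| |1|_q |k|_p, and a constant c has norm |c| |1|_p on [Omega]. *)
pose K := 1 + `|m^-1| * Lnormr mu q%:E (\1_D) * Lnormr mu p (\1_D).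
have K0 : 0 < K.
  by rewrite /K ltr_wpDr ?ltr01// !mulr_ge0 ?Lnormr_ge0.
exists (C * K) => [|g G gG]; first by rewrite mulr_gt0.
have [gq gw _] := gG.
have B := Eq_space_Lfun_enorm gG.
have ig := LpOn_integrable gq.
set c := mean Omega g.
have hq : LpOn Omega q%:E (fun x => g x - c) by exact: LpOn_sub_cst.
rewrite (LnormOnE hq) (LnormOnE B) -EFinM lee_fin.
pose h : T -> R := (fun x => g x - c) \_ D.
have [k [kp hk kN]] := dual_function p1 q1 pq (hq : h \in Lfun mu q%:E).
pose N := Lnormr mu q%:E h; rewrite -/h -/N.
have N0 : 0 <= N by exact: Lnormr_ge0.
have kDp : LpOn Omega p k.
  apply: Lfun_le (kp) _ => //.
    by apply/patch_measurable/measurable_funTS; move/LfunPl: kp => [].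
  by move=> x; rewrite /patch; case: ifP; rewrite // normr0.
have kDN : Lnormr mu p (k \_ D) <= N `^ (q - 1).
  apply: le_trans kN; apply: le_Lnormr => //.
    by apply/patch_measurable/measurable_funTS; move/LfunPl: kp => [].
  by move=> x; rewrite /patch; case: ifP; rewrite // normr0.
pose f x := k x - mean Omega k.
have fp : LpOn Omega p f by exact: LpOn_sub_cst.
have L1 : LpOn Omega q%:E (fun=> 1).
  by apply: eq_Lfun Dq => x; rewrite /patch indicE; case: (x \in D).
have [ik leik] := LpOn_hoelder kDp L1.
have {}ik : mu.-integrable D (EFin \o k).
  by apply: eq_integrable ik => // x _; rewrite mulr1.
have f0 : \int[mu]_(x in Omega) f x = 0 by exact: Rintegral_sub_mean.
have fN : Lnormr mu p (f \_ D) <= N `^ (q - 1) * K.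
  have -> : f \_ D = (fun x => (- mean Omega k) * \1_D x + (k \_ D) x).
    apply/funext => x; rewrite /f /patch indicE; case: (x \in D).
      by rewrite mulr1 addrC.
    by rewrite mulr0 addr0.
  apply: le_trans (Lnormr_addle p1E (Lfun_scaler _ p1E Dp) kDp) _.
  rewrite LnormrZ// normrN addrC /K mulrDr mulr1 lerD//.
  rewrite /mean normrM -/m -!mulrA [leRHS]mulrCA ler_wpM2l//.
  rewrite mulrA ler_wpM2r ?Lnormr_ge0//.
  have -> : \int[mu]_(x in Omega) k x = \int[mu]_(x in D) (k x * 1).
    by apply: eq_Rintegral => x _; rewrite mulr1.
  apply: le_trans leik _.
  have -> : (fun=> 1 : R) \_ D = \1_D :> (T -> R).
    by apply/funext => x; rewrite /patch indicE; case: (x \in D).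
  by rewrite ler_wpM2r ?Lnormr_ge0.
have [u [mu_ uE uN]] := divC f fp f0.
have iF : mu.-integrable D (EFin \o f).
  have [+ _] := LpOn_hoelder fp L1.
  by apply: eq_integrable => // x _; rewrite mulr1.
have [ifh _] := LpOn_hoelder fp hq.
have [ikh _] := LpOn_hoelder kDp hq.
have ih : mu.-integrable D (EFin \o (fun x => g x - c)) by exact: LpOn_integrable.
(* Two exchanges: [f] has mean zero, so [g] may be replaced by [g - c]; this has mean zero in turn,
   so [f] may be replaced by [k], for which the integrand is |h|^q. *)
have fgE : \int[mu]_(x in D) (f x * g x) = N `^ q.
  have -> : \int[mu]_(x in D) (f x * g x) =
      \int[mu]_(x in D) (f x * (g x - c) + c * f x).
    by apply: eq_Rintegral => x _; ring.
  rewrite RintegralD//; last exact: integrableZl iF.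
  rewrite RintegralZl// f0 mulr0 addr0.
  have -> : \int[mu]_(x in D) (f x * (g x - c)) =
      \int[mu]_(x in D) (k x * (g x - c) - mean Omega k * (g x - c)).
    by apply: eq_Rintegral => x _; rewrite /f mulrBl.
  rewrite RintegralB//; last exact: integrableZl ih.
  rewrite RintegralZl// Rintegral_sub_mean// mulr0 subr0 Rintegral_patchM.
  have -> : \int[mu]_x ((k \_ D) x * ((fun x => g x - c) \_ D) x) =
      \int[mu]_x (`|h x| `^ q).
    apply: eq_Rintegral => x _; rewrite -hk mulrC /h /patch.
    by case: (x \in D); rewrite ?mul0r.
  by rewrite /Rintegral (Lnormr_powR q1 hq).
pose A : T -> R := (fun x => (w x)^-1 * enorm (u x)) \_ D.
have mA : measurable_fun setT A by exact: measurable_unweighted.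
have Ap : A \in Lfun mu p.
  apply/LfunPl; split => //; apply: le_lt_trans uN _.
  by rewrite (LnormOnE fp) -EFinM ltry.
have AN : Lnormr mu p A <= C * (N `^ (q - 1) * K).
  have : Lnormr mu p A <= C * Lnormr mu p (f \_ D).
    by rewrite -lee_fin EFinM -(LnormOnE fp) -LnormrE.
  by move=> /le_trans; apply; rewrite ler_pM2l.
have muG : measurable_fun D (fun x : T => edot (u x) (G x)).
  exact (measurable_edot mu_ (fun i => Eq_space_measurable i gG)).
have uGle x : `|((fun x : T => edot (u x) (G x)) \_ D) x| <=
    A x * ((fun x : T => w x * enorm (G x)) \_ D) x.
  rewrite /A /patch; case: ifPn => [/set_mem Dx|_]; last by rewrite normr0 mulr0.
  (* A nonzero weight allows the splitting of u . G into u / w and w G. *)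
  have wx : w x != 0 by rewrite gt_eqF// w0.
  rewrite mulrACA mulrC -[(w x)^-1 * _]mulrC.
  by rewrite divff// mulr1 normr_edot_le.
have iAB := integrable_hoelder p1 q1 pq Ap B.
have iuG : mu.-integrable setT (EFin \o ((fun x : T => edot (u x) (G x)) \_ D)).
  apply: (le_integrable measurableT _ _ iAB).
    by apply/measurable_EFinP/patch_measurable.
  by move=> x _; rewrite lee_fin; apply: le_trans (uGle x) (ler_norm _).
have NAB : N `^ q <= Lnormr mu p A * Lnormr mu q%:E ((fun x => w x * enorm (G x)) \_ D).
  have := uE g G gG; rewrite fgE => /(congr1 Num.norm).
  rewrite normrN [in X in _ = X -> _]ger0_norm ?powR_ge0// => <-.
  rewrite Rintegral_mkcond.
  apply: le_trans (le_normr_Rintegral measurableT iuG) _.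
  apply: le_trans (Rintegral_hoelder p1 q1 pq Ap B).
  apply: le_trans (ler_norm _); apply: le_Rintegral => //.
  exact: integrable_norm.
(* For N = 0 the claim is trivial; otherwise N^q <= C K N^(q-1) |w G|_q is divided by N^(q-1). *)
have [->|Nn0] := eqVneq N 0.
  by rewrite !mulr_ge0 ?Lnormr_ge0 ?ltW.
have Npos : 0 < N by rewrite lt_neqAle eq_sym Nn0.
have Nq0 : 0 < N `^ (q - 1) by exact: powR_gt0.
rewrite -(ler_pM2l Nq0) [leLHS]mulrC mulr_powRB1 ?(lt_le_trans ltr01)//.
apply: le_trans NAB _; rewrite mulrA; apply: ler_wpM2r; first exact: Lnormr_ge0.
by apply: le_trans AN _; rewrite mulrCA.
Qed.

Lemma measurable_rV_continuous (f : 'rV[R]_n -> R) : continuous f ->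
  measurable_fun [set: T] (f : T -> R).
Proof.
move=> cf mT; apply: (measurability _ (RGenOInfty.measurableE R)).
  move=> _ [_ [a ->] <-]; rewrite setTI; apply: measurable_rV_open.
  by apply: open_comp => [x _|]; [exact: cf|exact: interval_open].
exact: mT.
Qed.

Lemma continuous_bounded_on (f : 'rV[R]_n -> R) : continuous f ->
  exists K : R, forall x, Omega x -> `|f x| <= K.
Proof.
move=> cf; have [M [_ MO]] := bOmega.
have OM x : Omega x -> `|x| <= `|M| + 1.
  by apply: MO; rewrite (le_lt_trans (ler_norm _))// ltrDl.
pose B : set 'rV[R]_n := [set x | `|x| <= `|M| + 1].
have cB : compact B.
  apply: bounded_closed_compact.
    exists (`|M| + 1); split; first exact: num_real.
    by move=> y My x /= /le_trans; apply; exact: ltW.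
  rewrite (_ : B = (fun x : 'rV[R]_n => `|x|) @^-1` [set y | y <= `|M| + 1])//.
  by apply: preimage_closed => [x _|]; [exact: norm_continuous|exact: closed_le].
have : compact (f @` B).
  by apply: continuous_compact => //; apply: continuous_subspaceT.
move=> /compact_bounded[K [_ KB]]; exists (`|K| + 1) => x /OM Bx.
apply: (KB (`|K| + 1)); last by exists x.
by rewrite (le_lt_trans (ler_norm _))// ltrDl.
Qed.

Lemma integrable_mul_bounded (A : set T) (f g : T -> R) (K : R) : measurable A ->
  mu.-integrable A (EFin \o f) -> measurable_fun A g ->
  (forall x, A x -> `|g x| <= K) -> mu.-integrable A (fun x => (f x * g x)%:E).
Proof.
move=> mA if_ mg gK; have iKf := integrableZl mA K if_.
apply: (le_integrable mA _ _ iKf).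
  apply/measurable_EFinP; apply: measurable_funM mg.
  by move/measurable_int : if_ => /measurable_EFinP.
move=> x Ax; rewrite /= lee_fin !normrM mulrC ler_wpM2r//.
exact: le_trans (gK x Ax) (ler_norm _).
Qed.

(** Integrals may be split only over integrable summands; this and [integrable_mul_test] justify the
    splitting on the two sides of the weak gradient identity. Here the derivative is bounded on the
    bounded set [Omega] and [g] is integrable there. *)
Lemma integrable_mul_partial (g phi : 'rV[R]_n -> R) i : LpOn Omega q%:E g ->
  test_function Omega phi ->
  mu.-integrable D (fun x => (g x * partial i phi x)%:E).
Proof.
move=> /LpOn_integrable ig [sphi _ _]; have [cphi _] := sphi [:: i].
have [K phiK] := continuous_bounded_on cphi.
apply: (integrable_mul_bounded mD ig _ phiK).
exact: measurable_funTS (measurable_rV_continuous cphi).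
Qed.

(** [h] is only locally integrable, but the product vanishes off the compact support of [phi], where
    [h] is integrable. *)
Lemma integrable_mul_test (h phi : 'rV[R]_n -> R) :
  locally_integrable_on Omega h -> test_function Omega phi ->
  mu.-integrable D (fun x => (h x * phi x)%:E).
Proof.
move=> [mh ih] [sphi cS SO]; set S := closure _ in cS SO.
have [cphi _] := sphi [::].
have mS : measurable (S : set T).
  rewrite -[S]setCK; apply: measurableC; apply: measurable_rV_open.
  by apply: closed_openC; exact: closed_closure.
have [K phiK] := continuous_bounded_on cphi.
have iS : mu.-integrable (S : set T) (fun x => (h x * phi x)%:E).
  apply: (integrable_mul_bounded mS (ih _ cS SO) _ (fun x Sx => phiK x (SO x Sx))).
  exact: measurable_funTS (measurable_rV_continuous cphi).
apply/(integrable_mkcond _ mD); move/(integrable_mkcond _ mS) : iS.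
apply: eq_integrable => // x _; rewrite /patch.
case: (boolP (x \in (S : set T))) => [/set_mem Sx|/negP].
  by rewrite mem_set//; exact: SO.
rewrite inE => nS; case: ifP => // _.
have -> : phi x = 0; last by rewrite mulr0.
by apply/eqP/negPn/negP => phix; apply: nS; apply: subset_closure.
Qed.

Lemma LpOn_lin s (a : R) (f g : 'rV[R]_n -> R) : (1 <= s)%E ->
  LpOn Omega s f -> LpOn Omega s g -> LpOn Omega s (fun x => a * f x + g x).
Proof.
move=> s1 fs gs; apply: eq_Lfun (Lfun_lin a s1 fs gs) => x.
by rewrite (@patch_lin T R D a f g).
Qed.

Lemma Eq_space_lin a g G g' G' : Eq_space Omega gamma q g G ->
  Eq_space Omega gamma q g' G' ->
  Eq_space Omega gamma q (fun x => a * g x + g' x) (fun x => a *: G x + G' x).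
Proof.
move=> gG gG'; have [gq wG _] := gG; have [gq' wG' _] := gG'.
have mlin i : measurable_fun D (fun x : T => (a *: G x + G' x) ord0 i).
  rewrite (_ : (fun x => _) = fun x : T => a * G x ord0 i + G' x ord0 i).
    apply: measurable_funD; last exact: Eq_space_measurable gG'.
    by apply: measurable_funM; [exact: measurable_cst|exact: Eq_space_measurable gG].
  by apply/funext => x; rewrite !mxE.
split; first exact: LpOn_lin.
- move=> i; have [liG intG] := wG i; have [liG' intG'] := wG' i.
  split.
    split; first exact: mlin.
    move=> S cS SO; have [_ /(_ S cS SO) iG] := liG.
    have [_ /(_ S cS SO) iG'] := liG'.
    have mS : measurable (S : set T).
      rewrite -[S]setCK; apply: measurableC; apply: measurable_rV_open.
      by apply: closed_openC; apply: compact_closed => //; exact: norm_hausdorff.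
    have := integrableD mS (integrableZl mS a iG) iG'.
    by apply: eq_integrable => // x _; rewrite /= !mxE EFinD EFinM.
  move=> phi tphi.
  have ig := integrable_mul_partial i gq tphi.
  have ig' := integrable_mul_partial i gq' tphi.
  have iG := integrable_mul_test liG tphi.
  have iG' := integrable_mul_test liG' tphi.
  transitivity (\int[mu]_(x in D)
      (a * (g x * partial i phi x) + g' x * partial i phi x)).
    by apply: eq_Rintegral => x _; ring.
  rewrite (RintegralD mD (integrableZl mD a ig) ig') (RintegralZl a mD ig).
  rewrite intG// intG'//.
  transitivity (- \int[mu]_(x in D) (a * (G x ord0 i * phi x) + G' x ord0 i * phi x)).
    by rewrite (RintegralD mD (integrableZl mD a iG) iG') (RintegralZl a mD iG); ring.
  by congr (- _); apply: eq_Rintegral => x _; rewrite !mxE; ring.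
- apply: Lfun_coord_weighted => // i.
  have gL := Eq_space_Lfun_coord i gG; have gL' := Eq_space_Lfun_coord i gG'.
  apply: eq_Lfun (Lfun_lin a q1E gL gL').
  by move=> x; rewrite /patch; case: (x \in D); rewrite ?mulr0 ?addr0// !mxE; ring.
Qed.

Lemma Eq_space0 : Eq_space Omega gamma q (fun=> 0) (fun=> 0).
Proof.
have L0 : LpOn Omega q%:E (fun=> 0).
  by apply: eq_Lfun (Lfun_cst0 mu q1E) => x; rewrite /patch; case: ifP.
have i0 (S : set T) : mu.-integrable S (EFin \o (fun=> 0)) by exact: integrable0.
split => //.
- move=> i; split.
    split; first by under eq_fun do rewrite mxE; exact: measurable_cst.
    move=> S _ _; rewrite (_ : EFin \o _ = EFin \o (fun=> 0)); first exact: i0.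
    by apply/funext => x; rewrite /= mxE.
  move=> phi _; under eq_Rintegral do rewrite mul0r.
  under [in RHS]eq_Rintegral do rewrite mxE mul0r.
  by rewrite Rintegral_cstD mul0r oppr0.
- apply: Lfun_coord_weighted => i.
    by under eq_fun do rewrite mxE; exact: measurable_cst.
  by apply: eq_Lfun (Lfun_cst0 mu q1E) => x; rewrite /patch mxE mulr0; case: ifP.
Qed.

Local Notation LT := (LfunType mu q1E).

Lemma poincare_divergence_solvable : (0 < n)%N ->
  weighted_poincare Omega gamma q -> divergence_solvable Omega gamma p q.
Proof.
(* Each of the n components of u / w will have norm at most C |f|_p. *)
move=> n0 [C C0 poincC]; exists (n%:R * C) => [|f fp f0].
  by rewrite mulr_gt0// ltr0n.
pose M := C * Lnormr mu p (f \_ D).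
have M0 : 0 <= M by rewrite mulr_ge0 ?Lnormr_ge0// ltW.
have L1 : LpOn Omega q%:E (fun=> 1).
  by apply: eq_Lfun Dq => x; rewrite /patch indicE; case: (x \in D).
have iF : mu.-integrable D (EFin \o f).
  have [+ _] := LpOn_hoelder fp L1.
  by apply: eq_integrable => // x _; rewrite mulr1.
(* On a field with a single nonzero component the gauge is [M] times the norm of that component, so
   every coordinate functional inherits the bound [M]. *)
pose N (v : 'I_n -> LT) : R := M * \sum_i Lnormr mu q%:E (v i).
have Nsub v v' : N (v + v') <= N v + N v'.
  rewrite /N -mulrDr -big_split/=; apply: ler_wpM2l => //; apply: ler_sum => i _.
  exact: ler_LnormD.
have Nhom a v : 0 < a -> N (a *: v) = a * N v.
  move=> a0; rewrite /N [RHS]mulrCA; congr (_ * _); rewrite mulr_sumr.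
  apply: eq_bigr => i _.
  transitivity (Lnormr mu q%:E (fun x => a * v i x)).
    by congr (Lnormr _ _ _); apply/funext => x.
  by rewrite (LnormrZ a q1E (LfunP (v i))) ger0_norm ?ltW.
(* Several pairs [g], [G] may have the same weighted gradient; that they give the same value is part
   of what domination by [N] entails. *)
pose F := [set vr : ('I_n -> LT) * R | exists g G,
  [/\ Eq_space Omega gamma q g G,
    forall i x, vr.1 i x = ((fun x => w x * G x ord0 i) \_ D) x &
    vr.2 = - \int[mu]_(x in D) (f x * g x)]].
have domF : dominated_graph N F.
  split.
    move=> a [v r] [v' r'] [g [G [gG vE rE]]] [g' [G' [gG' vE' rE']]].
    exists (fun x => a * g x + g' x), (fun x => a *: G x + G' x); split.
    - exact: Eq_space_lin.
    - move=> i x /=; rewrite /= in vE vE'.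
      transitivity (a * v i x + v' i x); first by [].
      rewrite vE vE' /patch; case: (x \in D); rewrite ?mulr0 ?addr0//.
      by rewrite !mxE; ring.
    - rewrite /= in rE rE'; rewrite /= rE rE'.
      have [gq _ _] := gG; have [gq' _ _] := gG'.
      have [ifg _] := LpOn_hoelder fp gq; have [ifg' _] := LpOn_hoelder fp gq'.
      transitivity (- \int[mu]_(x in D) (a * (f x * g x) + f x * g' x)).
        rewrite (RintegralD mD (integrableZl mD a ifg) ifg').
        by rewrite (RintegralZl a mD ifg); ring.
      by congr (- _); apply: eq_Rintegral => x _; ring.
  move=> [v r] [g [G [gG vE rE]]]; rewrite /= in vE rE *; rewrite rE.
  have [gq _ _] := gG; set c := mean Omega g.
  have hq : LpOn Omega q%:E (fun x => g x - c) by exact: LpOn_sub_cst.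
  have B := Eq_space_Lfun_enorm gG.
  have := poincC g G gG; rewrite (LnormOnE hq) (LnormOnE B) -EFinM lee_fin => P.
  have [ifh leh] := LpOn_hoelder fp hq.
  have -> : \int[mu]_(x in D) (f x * g x) = \int[mu]_(x in D) (f x * (g x - c)).
    transitivity (\int[mu]_(x in D) (f x * (g x - c) + c * f x)).
      by apply: eq_Rintegral => x _; ring.
    rewrite (RintegralD mD ifh (integrableZl mD c iF)) (RintegralZl c mD iF).
    by rewrite f0 mulr0 addr0.
  apply: le_trans (ler_norm _) _; rewrite normrN; apply: le_trans leh _.
  rewrite /N /M [C * _]mulrC -mulrA; apply: ler_wpM2l; first exact: Lnormr_ge0.
  apply: le_trans P _; rewrite ler_pM2l//.
  have vL i : (fun x => `|v i x|) \in Lfun mu q%:E.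
    by exact (Lfun_abs q1E (LfunP (v i))).
  apply: le_trans (_ : Lnormr mu q%:E (fun x => \sum_i `|v i x|) <= _).
    apply: le_Lnormr => //; first by move/LfunPl: B => [].
      exact: Lfun_sum.
    move=> x; rewrite [leRHS]ger0_norm ?sumr_ge0// /patch.
    case: (boolP (x \in D)) => [xD|_]; last by rewrite normr0 sumr_ge0.
    rewrite ger0_norm; last exact: mulr_ge0 (weight_ge0 _ _ _) (enorm_ge0 _).
    apply: le_trans (ler_wpM2l (weight_ge0 _ _ _) (enorm_le_sum _)) _.
    rewrite mulr_sumr ler_sum// => i _; rewrite vE /patch xD normrM.
    by rewrite [in leRHS]ger0_norm ?weight_ge0.
  apply: le_trans (Lnormr_sum _ q1E vL) _; apply: ler_sum => i _.
  by rewrite Lnormr_abs.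
have F0 : F !=set0.
  exists (0, 0), (fun=> 0), (fun=> 0); split; first exact: Eq_space0.
    by move=> i x; rewrite /patch mxE mulr0; case: ifP.
  under eq_Rintegral do rewrite mulr0.
  by rewrite Rintegral_cstD mul0r oppr0.
have [ell [elllin ellN ellF]] := hahn_banach Nsub Nhom domF F0.
have ellD v v' : ell (v + v') = ell v + ell v'.
  by have := elllin 1 v v'; rewrite scale1r mul1r.
pose single i (phi : LT) : 'I_n -> LT := fun j => if j == i then phi else 0.
have ell0 : ell 0 = 0 by have := ellD 0 0; rewrite addr0; lra.
(* The Riesz representation takes functionals defined on all functions; the value 0 off L^q is
   arbitrary. *)
pose ell_ i (phi : T -> R) : R :=
  if pselect (phi \in Lfun mu q%:E) is left phiq
  then ell (single i (Lfun_Sub q1E phiq)) else 0.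
have ell_E i (phi : LT) : ell_ i phi = ell (single i phi).
  rewrite /ell_; case: pselect => [phiq|[]]; last exact: LfunP.
  by congr (ell (single i _)); apply/LfuneqP.
have Lnormr0 : Lnormr mu q%:E (0 : LT) = 0.
  have := LnormrZ 0 q1E (Lfun_cst0 mu q1E); rewrite normr0 [RHS]mul0r => <-.
  by congr (Lnormr _ _ _); apply/funext => x; rewrite mul0r.
have ell_lin i a (phi psi : T -> R) : phi \in Lfun mu q%:E -> psi \in Lfun mu q%:E ->
    ell_ i (fun x => a * phi x + psi x) = a * ell_ i phi + ell_ i psi.
  move=> phiq psiq.
  have -> : (fun x => a * phi x + psi x) =
      (a *: Lfun_Sub q1E phiq + Lfun_Sub q1E psiq : LT) by [].
  rewrite ell_E -[phi]/(Lfun_Sub q1E phiq : T -> R) ell_E.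
  rewrite -[psi]/(Lfun_Sub q1E psiq : T -> R) ell_E -elllin; congr ell.
  apply/funext => j; rewrite /single /=.
  transitivity (a *: (if j == i then Lfun_Sub q1E phiq else 0) +
    (if j == i then Lfun_Sub q1E psiq else 0)); last by [].
  by case: ifP; rewrite // scaler0 addr0.
have ell_le i (phi : T -> R) : phi \in Lfun mu q%:E ->
    `|ell_ i phi| <= M * Lnormr mu q%:E phi.
  move=> phiq.
  have Ns (psi : LT) : N (single i psi) = M * Lnormr mu q%:E psi.
    rewrite /N (bigD1 i)//= /single eqxx big1 ?addr0// => j /negPf ->.
    exact: Lnormr0.
  rewrite -[phi]/(Lfun_Sub q1E phiq : T -> R) ell_E ler_norml -Ns ellN andbT.
  rewrite lerNl; have := ellN (- single i (Lfun_Sub q1E phiq)).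
  have -> : ell (- single i (Lfun_Sub q1E phiq)) = - ell (single i (Lfun_Sub q1E phiq)).
    by apply/eqP; rewrite -addr_eq0 -ellD addNr ell0.
  have -> // : N (- single i (Lfun_Sub q1E phiq)) = N (single i (Lfun_Sub q1E phiq)).
  rewrite /N; congr (_ * _); apply: eq_bigr => j _.
  exact: LnormrN.
have /choice[h hP] : forall i, exists h : T -> R, [/\ h \in Lfun mu p,
    Lnormr mu p h <= M, forall x, ~ D x -> h x = 0 &
    forall g, g \in Lfun mu q%:E -> ell_ i (g \_ D) = \int[mu]_x (h x * g x)].
  move=> i.
  exact (riesz_representation (mu := mu) mD muD p1 q1 pq M0 (ell_lin i) (ell_le i)).
have hp i : h i \in Lfun mu p by have [] := hP i.
have mh i : measurable_fun D (h i).
  by apply: measurable_funTS; move/LfunPl: (hp i) => [].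
pose u x : 'rV[R]_n := \row_i (w x * h i x).
exists u; split.
- move=> i; rewrite (_ : (fun x => _) = (fun x : T => w x * h i x)).
    exact: measurable_funM mw (mh i).
  by apply/funext => x; rewrite mxE.
- move=> phi G gG.
  pose v i : LT := Lfun_Sub q1E (Eq_space_Lfun_coord i gG).
  have vE i x : v i x = ((fun x => w x * G x ord0 i) \_ D) x by [].
  have Fv : F (v, - \int[mu]_(x in D) (f x * phi x)) by exists phi, G.
  have /= <- := ellF _ Fv.
  have ellv : ell v = \sum_i ell_ i (v i).
    transitivity (ell (\sum_i single i (v i))).
      congr ell; apply/funext => j; rewrite fct_sumE (bigD1 j)//= big1 ?addr0.
        by rewrite /single eqxx.
      by move=> i /negPf ij; rewrite /single eq_sym ij.
    rewrite (big_morph ell ellD ell0); apply: eq_bigr => i _.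
    by rewrite ell_E.
  (* The density represents the functional after cutting off to [Omega], which leaves [v i]
     unchanged. *)
  have vD i : (v i : T -> R) \_ D = v i.
    apply/funext => x; rewrite [LHS]/patch; case: ifPn => // /negPf xD.
    by rewrite vE /patch xD.
  have ihv i : mu.-integrable setT (EFin \o (fun x => h i x * v i x)).
    exact: integrable_hoelder p1 q1 pq (hp i) (LfunP (v i)).
  rewrite ellv; transitivity (\sum_i \int[mu]_x (h i x * v i x)); last first.
    apply: eq_bigr => i _; have [_ _ _ hE] := hP i.
    by rewrite -hE ?vD//; exact: LfunP.
  have [_ <-] := Rintegral_sum (index_enum 'I_n) measurableT ihv.
  rewrite [LHS]Rintegral_mkcond /Rintegral; congr fine.
  apply: eq_integral => x _; congr EFin.
  rewrite [LHS]/patch; under [RHS]eq_bigr do rewrite vE /patch.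
  case: (x \in D); last by rewrite big1// => i _; rewrite mulr0.
  by apply: eq_bigr => i _; rewrite mxE; ring.
- have hH i : (fun x => `|h i x|) \in Lfun mu p by exact: Lfun_abs.
  have HL := Lfun_sum (index_enum 'I_n) xpredT p1E hH.
  rewrite (LnormOnE fp) -EFinM.
  apply: le_trans (_ : ('N[mu]_p[EFin \o (fun x => \sum_i `|h i x|)%R] <= _)%E).
    apply: le_Lnorm; [exact: lt_trans p1| |by move/LfunPl: HL => []|].
      apply: measurable_unweighted => i.
      rewrite (_ : (fun x => _) = (fun x : T => w x * h i x)).
        exact: measurable_funM mw (mh i).
      by apply/funext => x; rewrite mxE.
    move=> x; rewrite [leRHS]ger0_norm ?sumr_ge0// /patch.
    case: (x \in D); last by rewrite normr0 sumr_ge0.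
    rewrite (_ : u x = w x *: \row_i h i x); last by apply/rowP => i; rewrite !mxE.
    rewrite enormZ ger0_norm; last first.
      by rewrite !mulr_ge0 ?invr_ge0 ?enorm_ge0 ?weight_ge0.
    rewrite ger0_norm ?weight_ge0// mulrA.
    (* At a zero of the weight the inverse is 0 by convention, and so is the left-hand side. *)
    have [->|w0] := eqVneq (w x) 0; first by rewrite mulr0 mul0r sumr_ge0.
    rewrite mulVf// mul1r; apply: le_trans (enorm_le_sum _) _.
    by apply: ler_sum => i _; rewrite mxE.
  rewrite LnormrE// lee_fin; apply: le_trans (Lnormr_sum _ p1E hH) _.
  apply: le_trans (_ : \sum_(i < n) M <= _).
    apply: ler_sum => i _; have [_ hM _ _] := hP i; by rewrite Lnormr_abs.
  by rewrite sumr_const card_ord -[M *+ n]mulr_natl -mulrA.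
Qed.

End poincare_divergence.

Theorem proposition3p2 (R : realType) (n : nat) (Cn : R)
    (Omega : set 'rV[R]_n) (x0 : 'rV[R]_n)
    (gamma : R -> 'rV[R]_n -> 'rV[R]_n) (p : \bar R) (q : R) :
  (2 <= n)%N -> 0 < Cn ->
  open Omega -> connected Omega -> bounded_set Omega -> Omega x0 ->
  path_family Cn Omega x0 gamma ->
  (1 < p)%E -> 1 <= q -> (p^-1 + (q%:E)^-1 = 1)%E ->
  weighted_poincare Omega gamma q <-> divergence_solvable Omega gamma p q.
Proof.
move=> n2 _ oO _ bO Ox0 fam p1 q1 pq; have n0 : (0 < n)%N by exact: leq_trans n2.
split.
  exact: (poincare_divergence_solvable oO bO fam p1 q1 pq n0).
exact: (divergence_solvable_poincare oO bO fam p1 q1 pq n0 Ox0).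
Qed.
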